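(* For each polytope $P\subseteq\mathbb{R}^n$ with $v^{(\mathrm{sort})}\in P$ for each vertex $v$ of $P$ that admits an extended formulation with $n'$ variables and $f'$ inequalities, there is an extended formulation of $\Pi_{A_{n-1}}(P)$ with $n'+O(n\log n)$ variables and $f'+O(n\log n)$ inequalities.
   Context: $O(n\log n)$ stands for a quantity bounded by $C\,n\log n$ for all $n\ge 2$, where $C$ is an absolute constant (independent of $n$, $P$, $n'$, $f'$). For $y\in\mathbb{R}^n$, $y^{(\mathrm{sort})}\in\mathbb{R}^n$ is the vector obtained from $y$ by sorting its components in non-decreasing order. The group $A_{n-1}$ is generated by the reflections in $\mathbb{R}^n$ at the hyperplanes $\{x:x_k=x_\ell\}$ for all pairwise distinct $k,\ell\in\{1,\dots,n\}$, i.e., it is the group of all coordinate permutations. The $A_{n-1}$-permutahedron of a polytope $P\subseteq\mathbb{R}^n$ is $\Pi_{A_{n-1}}(P)=\operatorname{conv}\bigcup_{\gamma\in A_{n-1}}\gamma(P)$. An extended formulation of a polyhedron $P\subseteq\mathbb{R}^n$ with $d$ variables and $f$ inequalities is a description, by $f$ linear inequalities and arbitrarily many linear equations (which are not counted), of a polyhedron $Q\subseteq\mathbb{R}^d$, together with a linear map $\pi:\mathbb{R}^d\to\mathbb{R}^n$ with $\pi(Q)=P$. *)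

(* Defs.v *)
(* MathComp-Analysis *)
From mathcomp Require Export all_boot all_order all_algebra.
From mathcomp Require Export all_classical reals exp convex.

Set Implicit Arguments.
Unset Strict Implicit.
Unset Printing Implicit Defensive.

Import Order.TTheory GRing.Theory Num.Theory.
Local Open Scope classical_set_scope.
Local Open Scope ring_scope.

Definition conv_hull (R : realType) (n : nat) (S : set 'cV[R]_n) :
    set 'cV[R]_n :=
  smallest (@convex_set R 'cV[R]_n) S.

Definition dot (R : realType) (n : nat) (x y : 'cV[R]_n) : R :=
  \sum_(i < n) x i 0 * y i 0.

(* The empty set is a polytope. *)
Definition polytope (R : realType) (n : nat) (P : set 'cV[R]_n) : Prop :=
  exists2 S : set 'cV[R]_n, finite_set S & P = conv_hull S.

(* c = 0 is allowed, so that P is a face of itself; this matters for the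
   vertex of a one-point polytope when n = 0. *)
Definition is_face (R : realType) (n : nat) (P F : set 'cV[R]_n) : Prop :=
  exists (c : 'cV[R]_n) (delta : R),
    (forall x, P x -> dot c x <= delta) /\
    F = P `&` [set x | dot c x = delta].

Definition is_vertex (R : realType) (n : nat) (P : set 'cV[R]_n)
    (v : 'cV[R]_n) : Prop :=
  is_face P [set v].

Definition sort_vec (R : realType) (n : nat) (y : 'cV[R]_n) : 'cV[R]_n :=
  \col_(i < n) nth 0 (sort <=%R [seq y j 0 | j <- enum 'I_n]) i.

Definition reflection (R : realType) (n : nat) (a : 'cV[R]_n) (x : 'cV[R]_n) :
    'cV[R]_n :=
  x - (2 * dot a x / dot a a) *: a.

(* The group of maps generated by the reflections at the hyperplanes with
   normal vectors in N. Reflections are involutions, so closure under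
   inverses is automatic. *)
Inductive reflection_group (R : realType) (n : nat) (N : set 'cV[R]_n) :
    set ('cV[R]_n -> 'cV[R]_n) :=
  | reflection_group_id : reflection_group N id
  | reflection_group_comp (a : 'cV[R]_n) (g : 'cV[R]_n -> 'cV[R]_n) :
      N a -> reflection_group N g -> reflection_group N (reflection a \o g).

(* A_(n-1): the hyperplane x_k = x_l has normal vector e_k - e_l. *)
Definition group_A (R : realType) (n : nat) : set ('cV[R]_n -> 'cV[R]_n) :=
  reflection_group
    [set a | exists k l : 'I_n, k != l /\ a = delta_mx k 0 - delta_mx l 0].
Arguments group_A R n : clear implicits.

Definition permutahedron (R : realType) (n : nat)
    (G : set ('cV[R]_n -> 'cV[R]_n)) (P : set 'cV[R]_n) : set 'cV[R]_n :=
  conv_hull (\bigcup_(g in G) (g @` P)).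

(* d variables, f inequalities; the number m of equations is not counted. *)
Definition has_extended_formulation (R : realType) (n : nat)
    (P : set 'cV[R]_n) (d f : nat) : Prop :=
  exists (m : nat) (A : 'M[R]_(f, d)) (b : 'cV[R]_f)
         (E : 'M[R]_(m, d)) (e : 'cV[R]_m)
         (p : {linear 'cV[R]_d -> 'cV[R]_n}),
    p @` [set y | (forall i, (A *m y) i 0 <= b i 0) /\ E *m y = e] = P.

(* Main.v *)
Require Import Defs.
From mathcomp Require Import fingroup perm interval_inference zify ring lra.
Import Order.TTheory GRing.Theory Num.Theory.

(* Comparators (i,j) put the minimum at i. Read backwards, a comparator becomes the
   convex relation z_i <= x_i <= z_j, x_i + x_j = z_i + z_j, which costs one
   variable and two inequalities, never leaves the permutahedron, and contains every
   run of the comparator. So if a network sorts, running its relations backwards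
   from P yields the permutahedron: P is the hull of its vertices, and each permuted
   vertex g v is sorted by the network to the sort of v, which lies in P. It remains
   to sort n numbers with O(n log n) comparators.

   Let n = 2^k. For a zero-one vector and a cut y, let err(y) be the lesser of the
   number of zeros to the right of y and the number of ones to its left; no
   comparator ever increases it. For the cell sizes m = 2^(k-1), ..., 2, 1 we keep
   err(y) <= c m 4^(-i) at all multiples y of 2^i m; for m = 1 this forces err = 0.
   To halve m, two sweeps are made over the dyadic tree with leaves of m cells. A
   node of 2^i m cells has two zones of m 4^(-i) cells, its prefix and its suffix.
   Bottom-up, the stray zeros (ones) in the zones of two siblings are collected into
   the prefix (suffix) of their parent; then the zones meeting at each cut are
   exchanged. Collecting and exchanging are done by halvers of quality q ~ 2^i,
   built from random bipartite expanders of degree O(q^2); the factor 2^i makes the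
   losses along a branch summable, and as 4^i m 4^(-i) = m every node of the tree
   costs O(m), hence every sweep O(n). *)

Set Implicit Arguments.
Unset Strict Implicit.
Unset Printing Implicit Defensive.

(** * Bipartite expanders *)

Lemma leq_exp2rW m n e : m <= n -> m ^ e <= n ^ e.
Proof. by case: e => // e le_mn; rewrite leq_exp2r. Qed.

Lemma ffact_leq_expn n k : n ^_ k <= n ^ k.
Proof.
by elim: k => // k IH; rewrite ffactnSr expnSr leq_mul // leq_subr.
Qed.

Lemma expn2_leq_fact k : 2 ^ k <= 2 * k`!.
Proof.
case: k => // k; rewrite expnS leq_mul2l /=; elim: k => // k IH.
by rewrite expnS factS leq_mul.
Qed.

(** Binomial expansion: ['C(a, k) / a ^ k <= 1 / k! <= 2 / 2 ^ k], and the geometric series sums to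
    less than 4. Multiplying by [2 ^ a] keeps everything in the naturals. *)
Lemma expn_succ_leq a : a.+1 ^ a <= 4 * a ^ a.
Proof.
rewrite -(@leq_pmul2l (2 ^ a)) ?expn_gt0 // -(addn1 a) expnDn big_distrr /=.
have term (k : 'I_a.+1) :
    2 ^ a * ('C(a, k) * (a ^ (a - k) * 1 ^ k)) <= 2 * a ^ a * 2 ^ (a - k).
  have le_ka : k <= a by rewrite -ltnS.
  rewrite exp1n muln1.
  have binle : 2 ^ k * 'C(a, k) <= 2 * a ^ k.
    have := leq_mul (expn2_leq_fact k) (leqnn 'C(a, k)).
    move/leq_trans; apply; rewrite -mulnA leq_mul2l /= mulnC bin_ffact.
    exact: ffact_leq_expn.
  have splitn c : c ^ a = c ^ k * c ^ (a - k) by rewrite -expnD subnKC.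
  rewrite !splitn.
  have := leq_mul binle (leqnn (2 ^ (a - k) * a ^ (a - k))); lia.
apply: (@leq_trans (\sum_(k < a.+1) 2 * a ^ a * 2 ^ (a - k))).
  by apply: leq_sum => k _; apply: term.
rewrite -big_distrr /=.
rewrite (_ : 2 ^ a * (4 * a ^ a) = 2 * a ^ a * (2 * 2 ^ a)); last by lia.
rewrite leq_mul2l; apply/orP; right.
rewrite (reindex_inj rev_ord_inj) /=.
under eq_bigr => i _ do rewrite subSS subKn -1?ltnS //.
rewrite -expnS -[leqRHS]prednK ?expn_gt0 // predn_exp mul1n.
by apply: leqW; apply: leq_sum => i _.
Qed.

Lemma expnn_leq_fact a : a ^ a <= 4 ^ a * a`!.
Proof.
elim: a => // a IH; rewrite expnS factS.
have := leq_mul (leqnn a.+1) (expn_succ_leq a).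
move/leq_trans; apply; rewrite expnS.
have := leq_mul (leqnn (4 * a.+1)) IH; lia.
Qed.

(** The usual bound (e w / a)^a on a binomial coefficient, with 4 for e and without division. *)
Lemma bin_expn_leq w a : 'C(w, a) * a ^ a <= 4 ^ a * w ^ a.
Proof.
have := leq_mul (leqnn 'C(w, a)) (expnn_leq_fact a).
rewrite mulnCA bin_ffact => /leq_trans; apply.
by rewrite leq_mul2l ffact_leq_expn orbT.
Qed.

(* Large enough for a union bound over the sets that violate expansion. *)
Definition expander_degree b := b.+1 + b * (3 * b + 3).

(** Divided by the right side: the number of pairs of sets of sizes [a] and [y], times the chance
    that all edges from the first end in the second, is at most 2^(-a). Of the factors y/w, [a] pay
    for ['C(w, a)], [b * a] pay for ['C(w, y)], and the remaining ones, each at most b/(b+1), pay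
    for the constants. *)
Lemma expander_union_bound b w a y :
  0 < b -> y * b.+1 <= b * w -> y <= b * a -> y <= w ->
  'C(w, a) * 'C(w, y) * y ^ (expander_degree b * a) * 2 ^ a <=
  w ^ (expander_degree b * a).
Proof.
move=> b_gt0 y_frac y_le y_le_w; rewrite /expander_degree.
set e := b * (3 * b + 3).
have E1 : 'C(w, a) * y ^ a <= b ^ a * (4 ^ a * w ^ a).
  apply: (@leq_trans ('C(w, a) * (b * a) ^ a)).
    by rewrite leq_mul2l leq_exp2rW ?orbT.
  by rewrite expnMn mulnCA leq_mul2l bin_expn_leq orbT.
have E2 : 'C(w, y) * y ^ (b * a) <= 4 ^ (b * a) * w ^ (b * a).
  have -> : b * a = y + (b * a - y) by rewrite subnKC.
  rewrite !expnD mulnA (leq_trans (leq_mul (bin_expn_leq w y) (leqnn _))) //.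
  rewrite -!mulnA leq_mul2l; apply/orP; right.
  rewrite mulnCA leq_mul2l; apply/orP; right.
  by rewrite -[leqLHS]mul1n leq_mul ?expn_gt0 // leq_exp2rW.
(* By Bernoulli (1 + 1/b)^b is at least 2, which contributes [2 ^ (3 * b + 3)]; this exceeds
   [8 * b * 4 ^ b] since [b < 2 ^ b]. *)
have E3 : 8 * b * 4 ^ b * b ^ e <= b.+1 ^ e.
  have bern : 2 * b ^ b <= b.+1 ^ b.
    rewrite -(addn1 b) expnDn; case: b b_gt0 {y_frac y_le e E1 E2} => // b _.
    rewrite big_ord_recl big_ord_recl /= !exp1n /bump /= subn0 bin0 bin1 mul1n muln1.
    by rewrite subSS subn0 muln1 -expnS addnA mul2n -addnn leq_addr.
  rewrite [b.+1 ^ e]expnM.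
  apply: leq_trans (leq_exp2rW (3 * b + 3) bern).
  rewrite expnMn -(expnM b b) -/e leq_mul2r; apply/orP; right.
  rewrite addnC expnD -mulnA leq_mul2l /= expnM (_ : 2 ^ 3 = 2 * 4) // expnMn.
  by rewrite leq_mul2r ltnW ?orbT // ltn_expl.
have E4 : y ^ e * (8 * b * 4 ^ b) <= w ^ e.
  rewrite -(@leq_pmul2r (b ^ e)) ?expn_gt0 ?b_gt0 // -mulnA.
  rewrite (leq_trans (leq_mul (leqnn _) E3)) // -!expnMn.
  by rewrite leq_exp2rW // [w * b]mulnC.
have {}E4 := leq_exp2rW a E4.
have -> : (b.+1 + e) * a = a + b * a + e * a by lia.
rewrite !expnD (expnM _ e).
apply: (@leq_trans (w ^ a * w ^ (b * a) * (y ^ e * (8 * b * 4 ^ b)) ^ a)).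
  have -> : (y ^ e * (8 * b * 4 ^ b)) ^ a =
      (y ^ e) ^ a * 2 ^ a * 4 ^ a * b ^ a * 4 ^ (b * a).
    by rewrite !expnMn -(expnM 4) (_ : 8 = 2 * 4) // expnMn !mulnA.
  have := leq_mul (leq_mul E1 E2) (leqnn ((y ^ e) ^ a * 2 ^ a)).
  by congr (_ <= _); lia.
by rewrite (expnM w e) leq_mul2l E4 orbT.
Qed.

(** * Existence of expanders by counting *)

Section Expander.
Variables (b w : nat).
Local Notation d := (expander_degree b).

(** The graph joins [i] to [F (k, i)] for every [k]. Multiple edges are allowed, so a random graph
    is a uniformly random function. *)
Definition nbrs (F : {ffun 'I_d * 'I_w -> 'I_w}) (X : {set 'I_w}) : {set 'I_w} :=
  [set F ky | ky in [set ky | ky.2 \in X]].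

(** The cap [(w - #|X|).+1] asks of a large [X] only that its neighbours outnumber its
    complement. *)
Definition expander (F : {ffun 'I_d * 'I_w -> 'I_w}) :=
  [forall X : {set 'I_w}, minn (w - #|X|).+1 (b * #|X|) <= #|nbrs F X|].

Lemma superset_card (A : {set 'I_w}) m :
  #|A| <= m <= w -> exists2 B : {set 'I_w}, A \subset B & #|B| = m.
Proof.
elim: m => [|m IH] /andP[le_Am le_mw].
  by exists A => //; apply/eqP; rewrite -leqn0.
move: le_Am; rewrite leq_eqVlt => /predU1P[eqA|lt_Am]; first by exists A.
have [|B subAB cardB] := IH; first by rewrite -ltnS lt_Am ltnW.
have [x xNB] : exists x, x \notin B.
  apply/existsP; rewrite -negb_forall; apply: contraTN le_mw => /forallP allB.
  rewrite -leqNgt -cardB -[leqLHS]card_ord subset_leq_card //.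
  exact/fintype.subsetP.
exists (x |: B); first exact: fintype.subset_trans subAB (finset.subsetUr _ _).
by rewrite cardsU1 xNB cardB.
Qed.

Lemma card_nbrs_subset (X Y : {set 'I_w}) :
  #|[set F | nbrs F X \subset Y]| = #|Y| ^ (d * #|X|) * w ^ (d * (w - #|X|)).
Proof.
pose Fam (ky : 'I_d * 'I_w) := [pred z | (ky.2 \in X) ==> (z \in Y)].
have -> : #|[set F | nbrs F X \subset Y]| = #|(family Fam : pred _)|.
  rewrite cardsE; apply: eq_card => F; rewrite !inE; apply/fintype.subsetP/forallP.
    move=> sub ky; rewrite inE; apply/implyP => kyX.
    by apply: sub; apply/imsetP; exists ky; rewrite ?inE.
  move=> fam y /imsetP[ky]; rewrite inE => kyX ->.
  by have := fam ky; rewrite inE kyX.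
rewrite card_family foldrE big_map big_enum /= (bigID (fun ky => ky.2 \in X)) /=.
have cardX (Z : {set 'I_w}) : #|[pred ky : 'I_d * 'I_w | ky.2 \in Z]| = d * #|Z|.
  rewrite -[d in RHS]card_ord -cardX; apply: eq_card => ky.
  by rewrite !inE.
rewrite (eq_bigr (fun=> #|Y|)); last first.
  by move=> ky kyX; rewrite kyX.
rewrite [X in _ * X](eq_bigr (fun=> w)); last first.
  by move=> ky kyX; rewrite (negPf kyX) /= -[RHS]card_ord.
rewrite !prod_nat_const cardX; congr (_ * _ ^ _).
rewrite -(eq_card (A := [pred ky : 'I_d * 'I_w | ky.2 \in ~: X])); last first.
  by move=> ky; rewrite !inE.
by rewrite cardX cardsCs finset.setCK card_ord.
Qed.

(** Union bound: a graph that fails has a nonempty [X], of [a] elements say, whose neighbours all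
    lie in a set of [minn (w - a) (b * a).-1] elements. These events have total probability at most
    the sum of 2^(-a) over 1 <= a <= w, which is less than 1. *)
Lemma expander_exists : 0 < b -> exists F, expander F.
Proof.
move=> b_gt0; apply/existsP; apply: contraT; rewrite negb_exists => /forallP nexp.
pose y a := minn (w - a) (b * a).-1.
pose N := w ^ (d * w).
have NE : N = #|{: {ffun 'I_d * 'I_w -> 'I_w}}|.
  by rewrite card_ffun card_prod !card_ord.
pose t a := 'C(w, y a) * (y a ^ (d * a) * w ^ (d * (w - a))).
have draws k : 'C(w, k) = #|[set A : {set 'I_w} | #|A| == k]|.
  by rewrite card_draws card_ord.
have cover : N <= \sum_(X : {set 'I_w} | 0 < #|X|) t #|X|.
  rewrite NE -sum1_card.
  apply: (@leq_trans (\sum_F \sum_(X : {set 'I_w} | 0 < #|X|)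
      \sum_(Y : {set 'I_w} | #|Y| == y #|X|) (nbrs F X \subset Y))).
    apply: leq_sum => F _.
    have [X] : exists X : {set 'I_w}, #|nbrs F X| < minn (w - #|X|).+1 (b * #|X|).
      have := nexp F; rewrite /expander negb_forall => /existsP[X].
      by rewrite -ltnNge; exists X.
    move=> small; have X_gt0 : 0 < #|X|.
      by rewrite lt0n; apply: contraTneq small => ->; rewrite muln0 minn0.
    have bX_gt0 : 0 < b * #|X| by rewrite muln_gt0 b_gt0.
    have [|Y subY cardY] := @superset_card (nbrs F X) (y #|X|).
      rewrite (leq_trans (geq_minl _ _)) ?leq_subr // andbT -ltnS.
      by rewrite (leq_trans small) // /y -minnSS prednK.
    rewrite (bigD1 X) //= (bigD1 Y) /= ?cardY // subY.
    by rewrite -addnA leq_addr.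
  rewrite exchange_big /=; apply: leq_sum => X _.
  rewrite exchange_big /= /t draws -sum_nat_const big_mkcond /= [leqRHS]big_mkcond /=.
  apply: leq_sum => Y _; rewrite inE; case: eqP => // cardY.
  rewrite -cardY -card_nbrs_subset -sum1_card [leqRHS]big_mkcond /=.
  by apply: leq_sum => F _; rewrite inE; case: (_ \subset _).
have bound a : a <= w -> 'C(w, a) * t a * 2 ^ a <= N.
  move=> le_aw; rewrite /t.
  have : y a <= w by rewrite (leq_trans (geq_minl _ _)) ?leq_subr.
  have yb : y a <= b * a by rewrite (leq_trans (geq_minr _ _)) ?leq_pred.
  have yw : y a <= w - a by rewrite geq_minl.
  (* Add [b] times [y a <= w - a] to [y a <= b * a]. *)
  move=> yw'; have yf : y a * b.+1 <= b * w.
    have := leq_mul (leqnn b) yw; have := leq_mul (leqnn b) le_aw.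
    by rewrite mulnBr; lia.
  have := expander_union_bound b_gt0 yf yb yw'.
  move=> /leq_mul /(_ (leqnn (w ^ (d * (w - a))))).
  rewrite -expnD -mulnDr subnKC // -/N; congr (_ <= _); lia.
have sumE : \sum_(X : {set 'I_w} | 0 < #|X|) t #|X| =
    \sum_(1 <= a < w.+1) 'C(w, a) * t a.
  under [RHS]eq_bigr => a _.
    rewrite draws -sum_nat_const.
    under eq_bigl do rewrite inE.
    over.
  rewrite (exchange_big_dep (fun X : {set 'I_w} => true)) //= big_mkcond /=.
  apply: eq_bigr => X _.
  under [RHS]eq_bigl do rewrite eq_sym.
  rewrite big_nat1_eq ltnS; case: ltnP => //= _.
  by rewrite -[w in _ <= w]card_ord max_card.
have total : 2 ^ w * (\sum_(1 <= a < w.+1) 'C(w, a) * t a) < 2 ^ w * N.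
  apply: (@leq_ltn_trans (\sum_(1 <= a < w.+1) 2 ^ (w - a) * N)).
    rewrite big_distrr /= !big_nat; apply: leq_sum => a /andP[_ le_aw].
    have := leq_mul (leqnn (2 ^ (w - a))) (bound a le_aw).
    by rewrite mulnCA -expnD subnK // mulnC.
  rewrite -big_distrl /= ltn_pmul2r; last first.
    by rewrite expn_gt0 muln_eq0 [w == 0]eqn0Ngt; case: (0 < w); rewrite ?orbT.
  rewrite -[ltnRHS]prednK ?expn_gt0 // predn_exp mul1n ltnS.
  rewrite big_add1 big_mkord (reindex_inj rev_ord_inj) /=.
  by apply: leq_sum => i _; rewrite subnSK // subKn // ltnW.
by move: total; rewrite ltn_pmul2l ?expn_gt0 // ltnNge -sumE cover.
Qed.
End Expander.

(** * Comparator networks on zero-one vectors *)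

Definition compare d (T : orderType d) (c : nat * nat) (x : nat -> T) : nat -> T :=
  fun k => if k == c.1 then Order.min (x c.1) (x c.2)
           else if k == c.2 then Order.max (x c.1) (x c.2) else x k.

Definition run d (T : orderType d) (s : seq (nat * nat)) (x : nat -> T) : nat -> T :=
  foldl (fun y c => compare c y) x s.

Lemma run_cat d (T : orderType d) s1 s2 (x : nat -> T) :
  run (s1 ++ s2) x = run s2 (run s1 x).
Proof. exact: foldl_cat. Qed.

Lemma run_id d (T : orderType d) s (x : nat -> T) k :
  all (fun c => (c.1 != k) && (c.2 != k)) s -> run s x k = x k.
Proof.
elim: s x => //= c s IH x /andP[/andP[c1 c2] /IH ->].
by rewrite /compare eq_sym (negPf c1) eq_sym (negPf c2).
Qed.

(** Monotone maps commute with minimum and maximum. This is the source of the zero-one principle. *)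
Lemma run_homo d d' (T : orderType d) (T' : orderType d') (f : T -> T') s x :
  {homo f : a b / (a <= b)%O} -> run s (f \o x) =1 f \o run s x.
Proof.
move=> f_homo; elim: s x => //= c s IH x k.
rewrite -[RHS]/((f \o _) k) -IH; congr (run _ _ k).
apply: funext => l /=; rewrite /compare /=; case: ifP => _; last case: ifP => _ //.
  by case: (leP (x c.1) (x c.2)) => [/f_homo/min_idPl //|/ltW/f_homo/min_idPr].
by case: (leP (x c.1) (x c.2)) => [/f_homo/max_idPr //|/ltW/f_homo/max_idPl].
Qed.

Section ZeroOneNetworks.
Implicit Types (x : nat -> bool) (b : bool) (c : nat * nat) (s : seq (nat * nat)).

Definition cnt b x lo hi := \sum_(lo <= k < hi) (x k == b).

Definition inversion c x := x c.1 && ~~ x c.2.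

Lemma cnt_split b x lo mid hi : lo <= mid <= hi ->
  cnt b x lo hi = cnt b x lo mid + cnt b x mid hi.
Proof. by case/andP=> lm mh; rewrite /cnt (big_cat_nat lm mh). Qed.

Lemma cntC b x lo hi : cnt b x lo hi + cnt (~~ b) x lo hi = hi - lo.
Proof.
rewrite /cnt -big_split /= -[RHS]muln1 -sum_nat_const_nat; apply: eq_bigr => k _.
by case: (x k); case: b.
Qed.

Lemma cnt_le b x lo hi : cnt b x lo hi <= hi - lo.
Proof. by rewrite -(cntC b x) leq_addr. Qed.

Lemma eq_cnt b x y lo hi : (forall k, lo <= k < hi -> x k = y k) ->
  cnt b x lo hi = cnt b y lo hi.
Proof. by move=> xy; rewrite /cnt !big_nat; apply: eq_bigr => k /xy ->. Qed.

(** A comparator changes [x] only at an inversion, where a zero moves from [c.2] to [c.1]. The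
    additive form avoids truncated subtraction. *)
Lemma compareE c x k : c.1 != c.2 ->
  (compare c x k == false) + (k == c.2) && inversion c x =
  (x k == false) + (k == c.1) && inversion c x.
Proof.
rewrite /compare /inversion; case: c => i j /= ij.
have [->|ki] := eqVneq k i; first by rewrite (negPf ij); case: (x i); case: (x j).
by have [->|kj] := eqVneq k j; case: (x i); case: (x j).
Qed.

Lemma cnt_compare c x lo hi : c.1 != c.2 ->
  cnt false (compare c x) lo hi + (lo <= c.2 < hi) && inversion c x =
  cnt false x lo hi + (lo <= c.1 < hi) && inversion c x.
Proof.
move=> cneq; have sumE j (v : bool) : ((lo <= j < hi) && v : nat) =
    \sum_(lo <= k < hi) ((k == j) && v).
  have := big_nat1_eq addn (fun k => v : nat) j lo hi; rewrite /= big_mkcond /= => E.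
  transitivity (if lo <= j < hi then v : nat else 0); first by case: ifP.
  by rewrite -E; apply: eq_bigr => k _; case: (k == j).
rewrite !sumE /cnt -!big_split /=; apply: eq_bigr => k _; exact: compareE.
Qed.

Definition inside lo hi s := all (fun c => (lo <= c.1) && (c.1 < c.2 < hi)) s.

Lemma inside_cat lo hi s1 s2 :
  inside lo hi (s1 ++ s2) = inside lo hi s1 && inside lo hi s2.
Proof. exact: all_cat. Qed.

Lemma inside_sub lo hi lo' hi' s : lo' <= lo -> hi <= hi' ->
  inside lo hi s -> inside lo' hi' s.
Proof. by move=> lolo hihi; apply: sub_all => c /=; lia. Qed.

Lemma zeros_tail_run n s x y : inside 0 n s ->
  cnt false (run s x) y n <= cnt false x y n.
Proof.
elim: s x => //= c s IH x /andP[c_lt /IH IHs]; apply: leq_trans (IHs _) _.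
have := @cnt_compare c x y n; case: (inversion c x); rewrite ?andbT ?andbF; lia.
Qed.

Lemma ones_head_run n s x y : inside 0 n s ->
  cnt true (run s x) 0 y <= cnt true x 0 y.
Proof.
elim: s x => //= c s IH x /andP[c_lt /IH IHs]; apply: leq_trans (IHs _) _.
have := @cnt_compare c x 0 y; have := cntC true x 0 y.
have := cntC true (compare c x) 0 y.
by case: (inversion c x); rewrite ?andbT ?andbF /=; lia.
Qed.

Lemma cnt_run_outside b s x lo hi :
  all (fun c => ~~ (lo <= c.1 < hi) && ~~ (lo <= c.2 < hi)) s ->
  cnt b (run s x) lo hi = cnt b x lo hi.
Proof.
move=> /allP s_out; apply: eq_cnt => k k_in; apply: run_id; apply/allP => c /s_out.
case/andP=> c1 c2; apply/andP.
by split; [apply: contraNneq c1 | apply: contraNneq c2] => ->.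
Qed.

Lemma cnt_run_inside b s x lo hi : inside lo hi s ->
  cnt b (run s x) lo hi = cnt b x lo hi.
Proof.
move=> ins; have ext : cnt false (run s x) lo hi = cnt false x lo hi.
  elim: s x ins => //= c s IH x /andP[c_in ins].
  rewrite IH //; have := @cnt_compare c x lo hi.
  by case: (inversion c x); rewrite ?andbT ?andbF; lia.
case: b => //; have := cntC false x lo hi.
by have := cntC false (run s x) lo hi => /=; lia.
Qed.

(** All comparators lead from [L] to its complement, so values on [L] only decrease and values off
    [L] only increase: an order once established persists. *)
Lemma run_bipartite (L : pred nat) s x c :
  all (fun c => L c.1 && ~~ L c.2) s -> c \in s ->
  run s x c.1 ==> run s x c.2.
Proof.
have keep s' (y : nat -> bool) k : all (fun c => L c.1 && ~~ L c.2) s' ->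
    (L k -> run s' y k -> y k) /\ (~~ L k -> y k -> run s' y k).
  elim: s' y => //= e s' IH y /andP[/andP[e1 e2] /IH{}IH].
  have [IH1 IH2] := IH (compare e y); split=> Lk yk.
    have := IH1 Lk yk; rewrite /compare; have [->|_] := eqVneq k e.1.
      by case: (y e.1) => //; case: (y e.2).
    by have [ke|//] := eqVneq k e.2; rewrite -ke Lk in e2.
  apply: IH2 => //; rewrite /compare; have [ke|_] := eqVneq k e.1.
    by rewrite ke e1 in Lk.
  by have [ke|//] := eqVneq k e.2; rewrite -ke yk; case: (y _).
elim: s x => //= e s IH x /andP[/andP[e1 e2] sL]; rewrite inE.
case/predU1P=> [->|]; last exact: IH.
have [keep1 _] := keep s (compare e x) e.1 sL.
have [_ keep2] := keep s (compare e x) e.2 sL.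
apply/implyP => /(keep1 e1) h; apply: keep2 => //; move: h.
rewrite /compare eqxx; have [ee|_] := eqVneq e.2 e.1; first by rewrite ee e1 in e2.
by rewrite eqxx; case: (x e.1); case: (x e.2).
Qed.

Definition block w t u s :=
  all (fun c => (t <= c.1 < t + w) && (u <= c.2 < u + w)) s.

Lemma cnt_run_block b w t u s x : t + w <= u -> block w t u s ->
  cnt b (run s x) t (t + w) + cnt b (run s x) u (u + w) =
  cnt b x t (t + w) + cnt b x u (u + w).
Proof.
move=> tu blk.
have ext (y : nat -> bool) : block w t u s ->
    cnt false (run s y) t (t + w) + cnt false (run s y) u (u + w) =
    cnt false y t (t + w) + cnt false y u (u + w).
  elim: {blk} s y => //= c s IH y /andP[/andP[c1 c2] /IH{}IH].
  rewrite IH; have := @cnt_compare c y t (t + w); have := @cnt_compare c y u (u + w).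
  by case: (inversion c y); rewrite ?andbT ?andbF; lia.
case: b; last exact: ext.
have := ext x blk; have := cntC false x t (t + w); have := cntC false x u (u + w).
have := cntC false (run s x) t (t + w); have := cntC false (run s x) u (u + w) => /=.
lia.
Qed.

(** * Halvers from expanders *)

Section Halver.
Variables (q w : nat).
Local Notation d := (expander_degree q.-1).

(** The default is returned only if no expander exists, which [expander_exists] excludes for
    [1 < q]. *)
Definition some_expander : {ffun 'I_d * 'I_w -> 'I_w} :=
  odflt [ffun ky => ky.2] [pick F : {ffun 'I_d * 'I_w -> 'I_w} | expander F].

(** The expander is used in both directions: the first half acts on zeros left in the right block,
    the second on ones left in the left block. *)
Definition halver t u : seq (nat * nat) :=
  [seq (t + some_expander ky, u + ky.2) | ky : 'I_d * 'I_w <- enum {: 'I_d * 'I_w}] ++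
  [seq (t + ky.2, u + some_expander ky) | ky : 'I_d * 'I_w <- enum {: 'I_d * 'I_w}].

Lemma size_halver t u : 1 < q -> size (halver t u) <= 8 * q ^ 2 * w.
Proof.
move=> q_gt1; have -> : size (halver t u) = #|{: 'I_d * 'I_w}| + #|{: 'I_d * 'I_w}|.
  by rewrite cardE size_cat !size_map.
rewrite card_prod !card_ord -mulnDl.
rewrite leq_mul2r /expander_degree; apply/orP; right; nia.
Qed.

Lemma halver_block t u : block w t u (halver t u).
Proof.
by rewrite /block all_cat; apply/andP; split; apply/allP => c /mapP[ky _ ->] /=;
  rewrite !leq_addr !ltn_add2l !ltn_ord.
Qed.

Lemma cnt_card b x t : cnt b x t (t + w) = #|[set i : 'I_w | x (t + i) == b]|.
Proof.
rewrite /cnt -{1}[t]add0n big_addn addKn big_mkord -sum1_card.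
rewrite big_mkcond [RHS]big_mkcond /=.
by apply: eq_bigr => i _; rewrite inE addnC; case: (_ == _).
Qed.

Lemma some_expander_nbrs (X : {set 'I_w}) : 1 < q ->
  minn (w - #|X|).+1 (q.-1 * #|X|) <= #|nbrs some_expander X|.
Proof.
move=> q_gt1; rewrite /some_expander; case: pickP => [F /forallP //|no].
have b_gt0 : 0 < q.-1 by lia.
by have [F] := @expander_exists q.-1 w b_gt0; rewrite no.
Qed.

(** Since [#|Y| <= w - #|X|], the cap in the expansion is out of reach, so [q.-1 * #|X| <= #|Y|]. *)
Lemma halver_leftover (X Y : {set 'I_w}) : 1 < q ->
  nbrs some_expander X \subset Y -> #|X| + #|Y| <= w -> q * #|X| <= #|X| + #|Y|.
Proof.
move=> q_gt1 /subset_leq_card; have := some_expander_nbrs X q_gt1; nia.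
Qed.

(* A symbol left on the wrong side has all its neighbours carry the same symbol. *)
Lemma halverP b x t u : 1 < q -> t + w <= u ->
  let g := if b then t else u in
  cnt b x t (t + w) + cnt b x u (u + w) <= w ->
  q * cnt b (run (halver t u) x) g (g + w) <=
  cnt b x t (t + w) + cnt b x u (u + w).
Proof.
move=> q_gt1 tu; rewrite -(cnt_run_block b x tu (halver_block t u)).
set y := run _ x.
have ord c : c \in halver t u -> y c.1 ==> y c.2.
  apply: (@run_bipartite (fun k => k < t + w)); apply/allP => e e_in.
  by have /allP /(_ e e_in) := halver_block t u; lia.
have edge1 (ky : 'I_d * 'I_w) : y (t + some_expander ky) ==> y (u + ky.2).
  apply: (ord (_, _)); rewrite mem_cat; apply/orP; left.
  by apply/mapP; exists ky; rewrite ?mem_enum.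
have edge2 (ky : 'I_d * 'I_w) : y (t + ky.2) ==> y (u + some_expander ky).
  apply: (ord (_, _)); rewrite mem_cat; apply/orP; right.
  by apply/mapP; exists ky; rewrite ?mem_enum.
rewrite !cnt_card; case: b => /= small.
  rewrite cnt_card; apply: halver_leftover => //.
  apply/fintype.subsetP => i /imsetP[ky].
  by rewrite !inE !eqb_id => Xk ->; have := edge2 ky; rewrite Xk.
rewrite addnC in small *; rewrite cnt_card; apply: halver_leftover => //.
apply/fintype.subsetP => i /imsetP[ky].
by rewrite !inE !eqbF_neg => Xk ->; have := edge1 ky; rewrite (negPf Xk) implybF.
Qed.
End Halver.

Lemma block_inside lo hi w t u s : t + w <= u -> lo <= t -> u + w <= hi ->
  block w t u s -> inside lo hi s.
Proof. by move=> tu lot uhi; apply: sub_all => c /=; lia. Qed.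

Lemma cnt_run_block_id b w t u s x lo hi : block w t u s ->
  (hi <= t) || (t + w <= lo) -> (hi <= u) || (u + w <= lo) ->
  cnt b (run s x) lo hi = cnt b x lo hi.
Proof.
by move=> blk tout uout; apply: cnt_run_outside; apply: sub_all blk => c /=; lia.
Qed.

Lemma block_mono w t u s x : t + w <= u -> block w t u s ->
  cnt false x t (t + w) <= cnt false (run s x) t (t + w) /\
  cnt true x u (u + w) <= cnt true (run s x) u (u + w).
Proof.
move=> tu blk.
have -> : cnt true x u (u + w) <= cnt true (run s x) u (u + w) =
  (cnt false (run s x) u (u + w) <= cnt false x u (u + w)).
  have := cntC false x u (u + w); have := cntC false (run s x) u (u + w) => /=; lia.
have E := cnt_run_block false x tu blk.
suff le : cnt false x t (t + w) <= cnt false (run s x) t (t + w) by split => //; lia.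
elim: s x {E} blk => //= c s IH x /andP[c_in /IH{}IH]; apply: leq_trans (IH _).
have := @cnt_compare c x t (t + w).
by case: (inversion c x); rewrite ?andbT ?andbF; lia.
Qed.

(* A halver moving the symbol [b] into the zone at [z]. *)
Definition oriented_halver b q v z g := if b then halver q v g z else halver q v z g.

Definition oriented_before b v z g := if b then g + v <= z else z + v <= g.

Lemma oriented_halver_id b b' q v z g x lo hi :
  (hi <= z) || (z + v <= lo) -> (hi <= g) || (g + v <= lo) ->
  cnt b' (run (oriented_halver b q v z g) x) lo hi = cnt b' x lo hi.
Proof.
move=> zout gout; rewrite /oriented_halver; case: b.
  exact: cnt_run_block_id (halver_block _ _ _ _) gout zout.
exact: cnt_run_block_id (halver_block _ _ _ _) zout gout.
Qed.

(** If the two blocks hold at most [v] symbols [b], the halver leaves few of them at [g]. Otherwise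
    the opposite symbols number at most [v], and at most [v / q <= v / 2] of them stay in the zone,
    which is then half full of [b]. *)
Lemma oriented_halverP b q v z g x : 1 < q -> oriented_before b v z g ->
  let y := run (oriented_halver b q v z g) x in
  [/\ cnt b y z (z + v) + cnt b y g (g + v) = cnt b x z (z + v) + cnt b x g (g + v),
      cnt b x z (z + v) <= cnt b y z (z + v)
    & v <= 2 * cnt b y z (z + v) \/
      q * cnt b y g (g + v) <= cnt b x z (z + v) + cnt b x g (g + v)].
Proof.
move=> q_gt1; rewrite /oriented_halver /oriented_before.
case: b => ord; set y := run _ _.
  have blk := halver_block q v g z.
  have E := cnt_run_block true x ord blk; have [_ M] := block_mono x ord blk.
  split; [by move: E; rewrite -/y; lia | exact: M |].
  have Pt := @halverP q v true x g z q_gt1 ord.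
  have Pf := @halverP q v false x g z q_gt1 ord.
  have := cntC true x z (z + v); have := cntC true x g (g + v).
  have := cntC true y z (z + v); move: Pt Pf; rewrite -/y /=.
  have [small|big] := leqP (cnt true x g (g + v) + cnt true x z (z + v)) v.
    by move=> /(_ isT); lia.
  move=> _ Pf *; left; have few : cnt false x g (g + v) + cnt false x z (z + v) <= v.
    by lia.
  by have := Pf few; nia.
have blk := halver_block q v z g.
have E := cnt_run_block false x ord blk; have [M _] := block_mono x ord blk.
split; [exact: E | exact: M |].
have Pt := @halverP q v true x z g q_gt1 ord.
have Pf := @halverP q v false x z g q_gt1 ord.
have := cntC true x z (z + v); have := cntC true x g (g + v).
have := cntC true y z (z + v); move: Pt Pf; rewrite -/y /=.
have [small|big] := leqP (cnt false x z (z + v) + cnt false x g (g + v)) v.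
  by move=> _ /(_ isT); lia.
move=> Pt _ *; left; have few : cnt true x z (z + v) + cnt true x g (g + v) <= v.
  by lia.
by have := Pt few; nia.
Qed.

(** The zone never loses a symbol [b], so once half full it remains so. Until then each chunk, at
    its turn, keeps at most a fraction [1 / q] of the total. *)
Lemma collectP b q v z gs x : 1 < q -> all (oriented_before b v z) gs ->
  pairwise (fun g g' => (g + v <= g') || (g' + v <= g)) gs ->
  let y := run (flatten [seq oriented_halver b q v z g | g <- gs]) x in
  let total x := cnt b x z (z + v) + \sum_(g <- gs) cnt b x g (g + v) in
  [/\ total y = total x, cnt b x z (z + v) <= cnt b y z (z + v)
    & v <= 2 * cnt b y z (z + v) \/
      q * \sum_(g <- gs) cnt b y g (g + v) <= size gs * total x].
Proof.
move=> q_gt1; elim: gs x => [|g gs IH] x /=; first by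
  move=> _ _; rewrite !big_nil; split=> //; right; rewrite muln0.
move=> /andP[zg zgs] /andP[ggs gsgs]; rewrite run_cat !big_cons.
set y := run (oriented_halver _ _ _ _ _) x; set y' := run _ y.
have [E M D] := oriented_halverP x q_gt1 zg; rewrite -/y in E M D.
have [E' M' D'] := IH y zgs gsgs; rewrite -/y' in E' M' D'.
have sum_y :
    \sum_(g' <- gs) cnt b y g' (g' + v) = \sum_(g' <- gs) cnt b x g' (g' + v).
  apply: eq_big_seq => g' g'gs; apply: oriented_halver_id.
    by have := allP zgs _ g'gs; rewrite /oriented_before; case: (b); lia.
  by have := allP ggs _ g'gs; lia.
have g_id : cnt b y' g (g + v) = cnt b y g (g + v).
  rewrite /y'; elim: gs (y) zgs ggs {IH gsgs y' E' M' D' sum_y} => //= g' gs IH y0.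
  move=> /andP[zg' zgs] /andP[gg' ggs]; rewrite run_cat IH //.
  by apply: oriented_halver_id; [move: zg; rewrite /oriented_before; case: (b); lia|lia].
move: E' D'; rewrite !sum_y g_id; split; [lia|lia|].
have [|{}D] := D; first by lia.
have [|{}D'] := D'; first by lia.
right; rewrite mulnDr mulSn; apply: leq_add.
  by apply: leq_trans D _; lia.
apply: leq_trans D' _; rewrite leq_mul2l; apply/orP; right; lia.
Qed.

(** * Dyadic trees, zones and cuts *)

Lemma cnt_sub b x lo hi lo' hi' : lo <= lo' <= hi' -> hi' <= hi ->
  cnt b x lo' hi' <= cnt b x lo hi.
Proof.
move=> lo_le hi_le.
by rewrite (@cnt_split b x lo lo' hi) ?(@cnt_split b x lo' hi' hi); lia.
Qed.

(* With [m] cells in a leaf, a node of scale [i] has [m * 2 ^ i] cells and its zones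
   have [width m i] cells; once [4 ^ i > m] they are empty. *)
Definition width m i := m %/ 4 ^ i.

Lemma widthS_le m i : 4 * width m i.+1 <= width m i.
Proof. by rewrite /width expnSr divnMA mulnC leq_divM. Qed.

(** For a power of two the division by 4 is exact as long as its quotient is positive. *)
Lemma widthS j i : 0 < width (2 ^ j) i.+1 ->
  width (2 ^ j) i = 4 * width (2 ^ j) i.+1.
Proof.
have expn4 k : 4 ^ k = 2 ^ (2 * k) by rewrite expnM.
rewrite /width divn_gt0 ?expn_gt0 // !expn4 leq_exp2l // => le_ij.
rewrite -!expnB //; last by lia.
by rewrite -(expnD 2 2); congr (2 ^ _); lia.
Qed.

Lemma width_le m i : width m i <= m.
Proof. exact: leq_div. Qed.

(** Both subtrees come before their root; [op] receives the scale of the children, one less than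
    that of the node. *)
Fixpoint tree (op : nat -> nat -> seq (nat * nat)) m i p :=
  if i is i'.+1 then
    tree op m i' p ++ tree op m i' (p + m * 2 ^ i') ++ op i' p
  else [::].

Lemma tree_inside op m i p :
  (forall i p, inside p (p + m * 2 ^ i.+1) (op i p)) ->
  inside p (p + m * 2 ^ i) (tree op m i p).
Proof.
move=> op_in; elim: i p => //= i IH p; rewrite !inside_cat op_in andbT.
by apply/andP; split; [have := IH p | have := IH (p + m * 2 ^ i)];
  apply: inside_sub; rewrite ?expnS; lia.
Qed.

(** The work below one node is a contiguous segment of the network, so all the rest can be treated
    as arbitrary comparators. *)
Lemma tree_split op m r i p k : k < 2 ^ r -> exists s1 s2,
  tree op m (i + r) p = s1 ++ tree op m i (p + m * 2 ^ i * k) ++ s2.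
Proof.
elim: r p k => [|r IH] p k.
  rewrite expn0 ltnS leqn0 => /eqP ->; exists [::], [::].
  by rewrite addn0 muln0 addn0 cats0.
move=> k_lt; rewrite addnS /=; have [k_small|k_big] := ltnP k (2 ^ r).
  have [s1 [s2 ->]] := IH p k k_small.
  by exists s1; eexists; rewrite -!catA.
have [|s1 [s2 ->]] := IH (p + m * 2 ^ (i + r)) (k - 2 ^ r).
  by rewrite expnS in k_lt; lia.
exists (tree op m (i + r) p ++ s1); eexists; rewrite -!catA; congr (_ ++ _ ++ _).
congr (tree _ _ _ _ ++ _); rewrite expnD mulnBr.
by have := leq_mul (leqnn (m * 2 ^ i)) k_big; lia.
Qed.

Lemma size_tree op m B i p :
  (forall i p, size (op i p) <= B) -> size (tree op m i p) <= B * 2 ^ i.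
Proof.
move=> op_B; suff : size (tree op m i p) + B <= B * 2 ^ i by lia.
elim: i p => [|i IH] p /=; first by rewrite muln1.
have := IH p; have := IH (p + m * 2 ^ i); have := op_B i p.
rewrite !size_cat expnS; lia.
Qed.

(* Zeros to the right of a cut and ones to its left; comparators increase neither. *)
Definition strays b n x y := if b then cnt true x 0 y else cnt false x y n.

Definition err n x y := minn (strays false n x y) (strays true n x y).

Lemma strays_run b n s x y : inside 0 n s -> strays b n (run s x) y <= strays b n x y.
Proof. by case: b; [exact: ones_head_run | exact: zeros_tail_run]. Qed.

Lemma err_run n s x y : inside 0 n s -> err n (run s x) y <= err n x y.
Proof.
by move=> ins; rewrite /err; have := strays_run false x y ins;
  have := strays_run true x y ins; lia.
Qed.

(** The zeros left of [y] are counted in two ways. Hence the difference of the two kinds of strays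
    depends only on [y] and the number of zeros, which comparators preserve. *)
Lemma strays_balance n x y : y <= n ->
  strays true n x y + cnt false x 0 n = y + strays false n x y.
Proof.
move=> le_yn; rewrite /strays (@cnt_split false x 0 y n) ?le_yn //.
by have := cntC true x 0 y => /=; lia.
Qed.

Lemma strays_split b n x y y' : y <= y' <= n ->
  strays b n x (if b then y' else y) =
  cnt b x y y' + strays b n x (if b then y else y').
Proof.
move=> ley; case: b; last exact: cnt_split.
by rewrite /strays (@cnt_split true x 0 y y') 1?addnC //; lia.
Qed.

Lemma strays_le b n x y y' :
  (if b then y <= y' else y' <= y) -> y <= n -> y' <= n ->
  strays b n x y <= strays b n x y'.
Proof. by case: b => le le_yn le_y'n; apply: cnt_sub; lia. Qed.

(** * One sweep over the dyadic tree *)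

Section Sweeps.
(* [q0] need only be large; the losses below are proportional to [1/q0]. *)
Variables (q0 : nat) (q0_ge : 2320 <= q0).

Definition quality i := q0 * 2 ^ i.

Lemma quality_ge i : q0 <= quality i.
Proof. by rewrite leq_pmulr // expn_gt0. Qed.

Lemma quality_gt1 i : 1 < quality i.
Proof. by have := quality_ge i; lia. Qed.

Definition zone b m i p := if b then p + m * 2 ^ i - width m i else p.

(* The cells of the zones of both children of a node of scale [i.+1] are cut
   into eight chunks, of which one becomes the zone of the node itself. *)
Definition chunks b m i p : seq nat :=
  let v := width m i.+1 in
  let a := zone b m i p in let a' := zone b m i (p + m * 2 ^ i) in
  if b then [:: a; a + v; a + 2 * v; a + 3 * v; a'; a' + v; a' + 2 * v]
  else [:: a + v; a + 2 * v; a + 3 * v; a'; a' + v; a' + 2 * v; a' + 3 * v].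

Definition target b m i p :=
  if b then zone b m i (p + m * 2 ^ i) + 3 * width m i.+1 else p.

Definition collect b m i p :=
  flatten [seq oriented_halver b (quality i) (width m i.+1) (target b m i p) g
          | g <- chunks b m i p].

Lemma chunks_before b m i p :
  all (oriented_before b (width m i.+1) (target b m i p)) (chunks b m i p).
Proof.
have W := widthS_le m i; have W' := width_le m i.
have h_ge : m <= m * 2 ^ i by rewrite leq_pmulr // expn_gt0.
by rewrite /chunks /target /oriented_before /zone; case: b => /=; lia.
Qed.

Lemma chunks_disjoint b m i p :
  pairwise (fun g g' => (g + width m i.+1 <= g') || (g' + width m i.+1 <= g))
    (chunks b m i p).
Proof.
have W := widthS_le m i; have W' := width_le m i.
have h_ge : m <= m * 2 ^ i by rewrite leq_pmulr // expn_gt0.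
rewrite /chunks /zone; case: b; rewrite /= !andbT; do !(apply/andP; split); lia.
Qed.

Lemma collect_inside b m i p : inside p (p + m * 2 ^ i.+1) (collect b m i p).
Proof.
have W := widthS_le m i; have W' := width_le m i.
have h_ge : m <= m * 2 ^ i by rewrite leq_pmulr // expn_gt0.
have := chunks_before b m i p.
have : all (fun g => (p <= g) && (g + width m i.+1 <= p + m * 2 ^ i.+1))
    (chunks b m i p).
  by rewrite /chunks /zone expnS; case: b => /=; lia.
have : p <= target b m i p /\ target b m i p + width m i.+1 <= p + m * 2 ^ i.+1.
  by rewrite /target /zone expnS; case: b => /=; lia.
rewrite /collect; move: (chunks b m i p) (target b m i p) => gs z [z_lo z_hi].
elim: gs => [//|g gs IH] /= /andP[g_in gs_in] /andP[gz gsz].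
rewrite inside_cat IH // andbT; move: gz; rewrite /oriented_halver /oriented_before.
by case: (b) => gz; apply: (block_inside gz _ _ (halver_block _ _ _ _)); lia.
Qed.

(* In the second alternative, the fraction of the symbols [b] of the node that the
   zone misses may grow with [i], but stays below [14 / q0]. *)
Definition collected b m i p x :=
  (0 < i /\ width m i <= 2 * cnt b x (zone b m i p) (zone b m i p + width m i)) \/
  cnt b x p (p + m * 2 ^ i) * quality i <=
    14 * (2 ^ i).-1 * cnt b x p (p + m * 2 ^ i) +
    cnt b x (zone b m i p) (zone b m i p + width m i) * quality i.

Lemma cnt_split4 b x a v w : w = 4 * v ->
  cnt b x a (a + w) = cnt b x a (a + v) + cnt b x (a + v) (a + v + v) +
    cnt b x (a + 2 * v) (a + 2 * v + v) + cnt b x (a + 3 * v) (a + 3 * v + v).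
Proof.
move=> ->; rewrite (@cnt_split b x a (a + v))
  ?(@cnt_split b x (a + v) (a + 2 * v) (a + 4 * v))
  ?(@cnt_split b x (a + 2 * v) (a + 3 * v) (a + 4 * v)); try lia.
by rewrite !addnA; congr (_ + cnt b x _ _ + cnt b x _ _ + cnt b x _ _); lia.
Qed.

(** A child with a half full zone supplies at least [2 * v] symbols, enough to half fill the zone of
    the node. Otherwise the fraction [14 * (2 ^ i).-1 / quality i] missed by the children grows by
    the collection loss [7 / quality i], and the sum is [14 * (2 ^ i.+1).-1 / quality i.+1]. *)
Lemma collect_step b j i p x (m := 2 ^ j) :
  collected b m i p x -> collected b m i (p + m * 2 ^ i) x ->
  collected b m i.+1 p (run (collect b m i p) x).
Proof.
set h := m * 2 ^ i => cA cB.
have [v0|v_gt0] := posnP (width m i.+1); first by left; rewrite v0.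
have W : width m i = 4 * width m i.+1 by exact: widthS.
have W' := width_le m i.
have h_ge : m <= h by rewrite /h leq_pmulr // expn_gt0.
set v := width m i.+1 in v_gt0 W *.
have Ez : zone b m i.+1 p = target b m i p.
  by rewrite /zone /target /zone expnS -/h -/v; case: b {cA cB}; lia.
rewrite /collected Ez -/v.
rewrite (cnt_run_inside _ _ (collect_inside b m i p)).
have [] :=
  collectP x (quality_gt1 i) (chunks_before b m i p) (chunks_disjoint b m i p).
rewrite -/(collect b m i p) -/v; set y := run _ x.
set z := target b m i p; set S := \sum_(g <- _) cnt b y g _.
set total := cnt b x z _ + _ => Etot _ D.
have Etotal : total = cnt b x (zone b m i p) (zone b m i p + width m i) +
    cnt b x (zone b m i (p + h)) (zone b m i (p + h) + width m i).
  rewrite !(cnt_split4 _ _ _ W) /total /z /chunks /target -/h -/v.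
  by case: (b); rewrite /= !big_cons big_nil /=; lia.
have Ev : cnt b x p (p + m * 2 ^ i.+1) =
    cnt b x p (p + h) + cnt b x (p + h) (p + h + h).
  rewrite (@cnt_split b x p (p + h)) ?expnS; last by lia.
  by congr (_ + cnt b x _ _); lia.
have zAle : cnt b x (zone b m i p) (zone b m i p + width m i) <= cnt b x p (p + h).
  by apply: cnt_sub; rewrite /zone; case: (b); lia.
have zBle : cnt b x (zone b m i (p + h)) (zone b m i (p + h) + width m i) <=
    cnt b x (p + h) (p + h + h).
  by apply: cnt_sub; rewrite /zone; case: (b); lia.
have [|{}D] := D; first by left.
have sizeE : size (chunks b m i p) = 7 by rewrite /chunks; case: (b).
rewrite sizeE in D.
have D' : 2320 * S <= 7 * total.
  by apply: leq_trans D; rewrite leq_mul2r (leq_trans q0_ge) ?quality_ge ?orbT.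
move: cA cB; rewrite /collected -/h.
move: zAle zBle Etotal Ev.
set zA := cnt b x (zone b m i p) _; set zB := cnt b x (zone b m i (p + h)) _.
set CA := cnt b x p _; set CB := cnt b x (p + h) _ => zAle zBle Etotal Ev.
case=> [[_ cA]|cA]; first by left; split => //; lia.
case=> [[_ cB]|cB]; first by left; split => //; lia.
right; rewrite Ev; move: cA cB D Etot; rewrite /quality expnS.
set e := 2 ^ i; set zy := cnt b y z _ => cA cB D Etot.
have : 0 < e by rewrite expn_gt0.
case: e cA cB D => // e cA cB D _.
move: cA cB D Etot Etotal; rewrite -/h -[e.+1.-1]/e.
set Q := q0 * e.+1 => cA cB D Etot Etotal.
have split_Q : zy * Q + S * Q = zA * Q + zB * Q by rewrite -!mulnDl Etot Etotal.
rewrite (_ : (2 * e.+1).-1 = 2 * e + 1); last by lia.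
rewrite (_ : q0 * (2 * e.+1) = 2 * Q); last by rewrite /Q; lia.
lia.
Qed.
Lemma collected_tree b j i p x (m := 2 ^ j) :
  collected b m i p (run (tree (collect b m) m i p) x).
Proof.
elim: i p x => [|i IH] p x.
  have zoneE : zone b m 0 p = p.
    by rewrite /zone /width muln1 divn1 addnK if_same.
  by right; rewrite zoneE /width muln1 divn1 muln0.
have ins := @tree_inside _ m i _ (collect_inside b m).
rewrite /= !run_cat; apply: collect_step => //.
have W := width_le m i.
have h_ge : m <= m * 2 ^ i by rewrite leq_pmulr // expn_gt0.
have same y lo hi : p <= lo -> hi <= p + m * 2 ^ i ->
    cnt b (run (tree (collect b m) m i (p + m * 2 ^ i)) y) lo hi = cnt b y lo hi.
  move=> lo_ge hi_le; apply: cnt_run_outside.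
  by apply: sub_all (ins (p + m * 2 ^ i)) => c /=; lia.
rewrite /collected !same //; first exact: IH.
all: by move: W h_ge; rewrite /m /zone; case: (b); lia.
Qed.

Definition exchange m i p :=
  halver (quality i) (width m i) (p + m * 2 ^ i - width m i) (p + m * 2 ^ i).

Lemma exchange_inside m i p : inside p (p + m * 2 ^ i.+1) (exchange m i p).
Proof.
have W := width_le m i.
have h_ge : m <= m * 2 ^ i by rewrite leq_pmulr // expn_gt0.
by apply: (block_inside _ _ _ (halver_block _ _ _ _)); rewrite ?expnS; lia.
Qed.

Definition sweep m l := tree (collect false m) m l 0 ++
  tree (collect true m) m l 0 ++ tree (exchange m) m l 0.

Lemma sweep_inside m l : inside 0 (m * 2 ^ l) (sweep m l).
Proof.
rewrite !inside_cat; apply/and3P; split; apply: tree_inside.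
- exact: collect_inside.
- exact: collect_inside.
- exact: exchange_inside.
Qed.

(* In the notation of [exchange_side]: [zB], [SB]: symbols [b] in the zone and beyond
   a cut after the collection; [zX], [SX]: before the exchange; [z1]: after it. *)
Lemma exchange_arith i w q cU zB SBx SBe SBf zX SXx SXe S0x S0x' SBx' SXx' z1 E :
  0 < w -> q0 * 2 ^ i = q -> zB <= w ->
  SBx = zB + SBe -> SBx = cU + SBf -> SBf <= E ->
  (0 < i /\ w <= 2 * zB) \/ cU * q <= 14 * (2 ^ i).-1 * cU + zB * q ->
  SXe <= SBe -> SXx = zX + SXe -> zX <= SXx' ->
  SXx' + SBx = SBx' + SXx -> SBx <= S0x -> SBx' <= S0x' ->
  (0 < i -> 4 * minn S0x S0x' <= w) -> q * z1 <= w ->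
  80 * (z1 + SXe) <= w + 80 * E.
Proof.
move=> w_gt0 <- zBw E1 E2 leE [[i_gt0 sat]|loss].
  (* A half full zone is contradictory: it makes [S0x] at least [w / 2], so the small error bounds
     [S0x'] by [w / 4], and the balance then gives [SXx' < zX]. *)
  by move=> ? ? ? ? ? ? /(_ i_gt0); lia.
move=> le_e E3 few bal le0 le0' _ left1.
have e_gt0 : 0 < 2 ^ i by rewrite expn_gt0.
have loss' : q0 * cU <= 14 * cU + q0 * zB.
  rewrite -(leq_pmul2r e_gt0); move: (2 ^ i) e_gt0 loss {left1} => [//|e] _ /=; lia.
have [zcU|zcU] := leqP cU zB.
  have : 2320 * z1 <= w.
    by apply: leq_trans left1; rewrite leq_mul2r -[2320]muln1 leq_mul ?orbT.
  by lia.
have loss2 : 2320 * (cU - zB) <= 14 * cU.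
  apply: (@leq_trans (q0 * (cU - zB))); first by rewrite leq_mul2r q0_ge orbT.
  by rewrite mulnBr; lia.
have : 2320 * z1 <= w.
  by apply: leq_trans left1; rewrite leq_mul2r -[2320]muln1 leq_mul ?orbT.
lia.
Qed.

(* One side of the exchange at the middle of the node of scale [i.+1] at [p]: the
   symbol [b] that is the less frequent one in the two exchanged zones is removed. *)
Lemma exchange_side b j i l p x s1 s2 s3 (m := 2 ^ j) (h := m * 2 ^ i)
    (n := m * 2 ^ l) (f := if b then p else p + h + h)
    (c := tree (collect b m) m i (if b then p else p + h))
    (xe := run (s1 ++ c ++ s2) x) :
  p + h + h <= n -> 0 < width m i ->
  (0 < i -> 4 * err n x (p + h) <= width m i) ->
  inside 0 n s1 -> inside 0 n c -> inside 0 n s2 -> inside 0 n s3 ->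
  strays b n x f <= err n x f ->
  cnt b xe (if b then p + h - width m i else p + h)
     (if b then p + h else p + h + width m i) <=
  cnt (~~ b) xe (if b then p + h else p + h - width m i)
     (if b then p + h + width m i else p + h) ->
  80 * err n (run (s1 ++ c ++ s2 ++ exchange m i p ++ s3) x) (p + h) <=
    width m i + 80 * err n x f.
Proof.
move=> p_n w_gt0 err_small in1 in_c in2 in4 far_err few.
have -> : run (s1 ++ c ++ s2 ++ exchange m i p ++ s3) x =
    run s3 (run (exchange m i p) xe) by rewrite /xe !run_cat.
move: few; have -> : xe = run s2 (run c (run s1 x)) by rewrite /xe !run_cat.
rewrite {}/xe; set xc := run c _; set xe := run s2 xc => few.
have W := width_le m i; set w := width m i in w_gt0 err_small few W *.
have h_ge : m <= h by rewrite /h leq_pmulr // expn_gt0.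
have in_e : inside 0 n (exchange m i p).
  by apply: inside_sub (exchange_inside m i p); rewrite // expnS; lia.
set x1 := run (exchange m i p) xe.
pose zone_lo := if b then p + h - w else p + h.
have lo_le : zone_lo <= zone_lo + w <= n by rewrite /zone_lo; case: (b); lia.
pose e := if b then p + h - w else p + h + w.
have splitw y : strays b n y (p + h) = cnt b y zone_lo (zone_lo + w) + strays b n y e.
  have := strays_split b y lo_le; rewrite /zone_lo /e.
  by case: (b); rewrite ?subnK //; lia.
have splitU y : strays b n y (p + h) =
    cnt b y (if b then p else p + h) ((if b then p else p + h) + h) + strays b n y f.
  have := @strays_split b n y (if b then p else p + h) ((if b then p else p + h) + h).
  by rewrite /f; case: (b) => -> //; lia.
have bal y :
    strays true n y (p + h) + cnt false y 0 n = p + h + strays false n y (p + h).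
  by apply: strays_balance; lia.
have kept s y : inside 0 n s -> cnt false (run s y) 0 n = cnt false y 0 n.
  exact: cnt_run_inside.
have mono_c b' y : strays b' n xc y <= strays b' n x y.
  exact: leq_trans (strays_run _ _ _ in_c) (strays_run _ _ _ in1).
have coll := collected_tree b j i (if b then p else p + h) (run s1 x).
rewrite -/m -/xc /collected -/h -/w in coll.
have zoneE : zone b m i (if b then p else p + h) = zone_lo.
  by rewrite /zone /zone_lo; case: (b).
rewrite zoneE in coll.
have sumw : cnt b xe (p + h - w) (p + h - w + w) + cnt b xe (p + h) (p + h + w) <= w.
  have := cntC b xe (p + h - w) (p + h); have := cntC b xe (p + h) (p + h + w).
  by rewrite subnK; [case: (b) few => /=; lia | lia].
have := @halverP (quality i) w b xe (p + h - w) (p + h)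
  (quality_gt1 i) _ sumw.
rewrite -/(exchange m i p) -/x1 => /(_ _)/leq_trans/(_ sumw) left1.
(* The strays of kind [b] alone bound the error: those left in the zone by the exchange, and those
   beyond it, whose number does not grow. *)
apply: leq_trans (_ : 80 * (cnt b x1 zone_lo (zone_lo + w) + strays b n xe e) <= _).
  rewrite leq_mul2l /=.
  have : err n (run s3 x1) (p + h) <= strays b n x1 (p + h).
    apply: leq_trans (err_run _ _ in4) _.
    by rewrite /err; case: (b); [exact: geq_minr | exact: geq_minl].
  move/leq_trans; apply; rewrite splitw leq_add2l; exact: strays_run.
apply: (@exchange_arith i w (quality i)
  (cnt b xc (if b then p else p + h) ((if b then p else p + h) + h))
  (cnt b xc zone_lo (zone_lo + w)) (strays b n xc (p + h)) (strays b n xc e)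
  (strays b n xc f) (cnt b xe zone_lo (zone_lo + w)) (strays b n xe (p + h))
  (strays b n xe e) (strays b n x (p + h))
  (strays (~~ b) n x (p + h)) (strays (~~ b) n xc (p + h))
  (strays (~~ b) n xe (p + h))) => //.
- by have := cnt_le b xc zone_lo (zone_lo + w); lia.
- exact: leq_trans (mono_c _ _) far_err.
- exact: strays_run.
- have -> : cnt b xe zone_lo (zone_lo + w) =
    cnt b xe (if b then p + h - w else p + h) (if b then p + h else p + h + w).
    by rewrite /zone_lo; case: (b); rewrite // subnK //; lia.
  apply: leq_trans few _; rewrite /strays.
  by case: (b); apply: cnt_sub; lia.
- have := bal xc; have := bal xe; rewrite /xe kept //; case: (b) => /=; lia.
- by move=> /err_small; rewrite /err; case: (b) => //; rewrite minnC.
- by move: left1; rewrite /zone_lo; case: (b) => //; apply; lia.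
Qed.

(** Induction from coarse to fine scales. A cut that is new at scale [i] is the middle of a node of
    scale [i.+1]; its error becomes at most [width m i / 80] plus the old error at an end of the
    node, where the bound is four times smaller. Scale 0 is absent from the hypothesis, since
    halving the cells creates its cuts. *)
Lemma sweepP j l al x (m := 2 ^ j) (n := m * 2 ^ l) : al <= 20 ->
  (forall i y, 0 < i <= l -> m * 2 ^ i %| y -> y <= n ->
     80 * 4 ^ i * err n x y <= al * m) ->
  forall i y, i <= l -> m * 2 ^ i %| y -> y <= n ->
     320 * 4 ^ i * err n (run (sweep m l) x) y <= (al + 4) * m.
Proof.
move=> al_le errx i y le_il; have := subnKC le_il; move: (l - i) => r.
elim: r i y {le_il} => [|r IH] i y irl dvd_y le_yn.
  suff -> : err n (run (sweep m l) x) y = 0 by rewrite muln0.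
  rewrite addn0 in irl; rewrite irl -/n in dvd_y.
  have [->|->] : y = 0 \/ y = n.
    by case/dvdnP: dvd_y le_yn => [[|[|k]]] ->; rewrite ?mul0n ?mul1n;
      [left | right |]; try lia.
  - by rewrite /err /strays /cnt (big_geq (leqnn 0)) minn0.
  - by rewrite /err /strays /cnt (big_geq (leqnn n)) min0n.
have [dvd_y'|ndvd_y] := boolP (m * 2 ^ i.+1 %| y).
  apply: leq_trans (IH i.+1 y _ dvd_y' le_yn); last by lia.
  by rewrite leq_mul2r expnS; lia.
set h := m * 2 ^ i in dvd_y.
have h_gt0 : 0 < h by rewrite muln_gt0 !expn_gt0.
have nE : n = h * 2 ^ r.+1 by rewrite /n -irl expnD mulnA.
case/dvdnP: dvd_y => k yE.
have k_odd : odd k.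
  apply: contraNT ndvd_y => k_even; rewrite yE expnS mulnCA -/h.
  by rewrite dvdn_pmul2r // dvdn2.
pose k' := k./2; have kE : k = k'.*2.+1 by rewrite -[LHS]odd_double_half k_odd.
pose p := m * 2 ^ i.+1 * k'.
have yph : y = p + h by rewrite yE kE /p expnS /h; lia.
have k'_lt : k' < 2 ^ r.
  have : h * k <= h * 2 ^ r.+1 by rewrite -nE [h * k]mulnC -yE.
  by rewrite leq_pmul2l // kE expnS; lia.
have phh : p + h + h <= n.
  rewrite nE expnS /p expnS -/h mulnCA -/h; have := leq_mul (leqnn h) k'_lt; lia.
have [errp errph] : 320 * 4 ^ i * err n (run (sweep m l) x) p <= (al + 4) * m /\
   320 * 4 ^ i * err n (run (sweep m l) x) (p + h + h) <= (al + 4) * m.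
  have le4 : 320 * 4 ^ i <= 320 * 4 ^ i.+1 by rewrite expnS; lia.
  have dvd_p : m * 2 ^ i.+1 %| p by rewrite dvdn_mulr.
  by split; apply: leq_trans (leq_mul le4 (leqnn _)) (IH i.+1 _ _ _ _); try lia => //;
    rewrite -addnA dvdn_addr // expnS /h; apply/dvdnP; exists 1; lia.
have in_s := sweep_inside m l; rewrite -/n in in_s.
set xf := run _ x in errp errph *.
have bal z y' : y' <= n ->
    strays true n z y' + cnt false z 0 n = y' + strays false n z y'.
  exact: strays_balance.
have kept : cnt false xf 0 n = cnt false x 0 n by apply: cnt_run_inside.
set K := cnt false x 0 n in kept.
have err_le b z y' : err n z y' <= strays b n z y'.
  by rewrite /err; case: b; rewrite ?geq_minr ?geq_minl.
(* A sorted vector changes symbol at [K]. If [K] is left of the node, the error at [y] is at most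
   the stray zeros at [p], which equal the error there, bounded by induction; likewise on the
   right. *)
have [K_lt|K_ge] := ltnP K p.
  apply: leq_trans errp; rewrite leq_mul2l; apply/orP; right.
  apply: leq_trans (err_le false _ _) _.
  apply: (@leq_trans (strays false n xf p)); first by apply: strays_le; lia.
  by have := bal xf p; rewrite /err; lia.
have [K_gt|K_le] := ltnP (p + h + h) K.
  apply: leq_trans errph; rewrite leq_mul2l; apply/orP; right.
  apply: leq_trans (err_le true _ _) _.
  apply: (@leq_trans (strays true n xf (p + h + h))); first by apply: strays_le; lia.
  by have := bal xf (p + h + h); rewrite /err; lia.
have m_gt0 : 0 < m by rewrite expn_gt0.
have err_y : 0 < i -> 4 * err n x y <= width m i.
  move=> i_gt0; rewrite /width leq_divRL ?expn_gt0 //.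
  have : 80 * 4 ^ i * err n x y <= al * m.
    by apply: errx => //; [lia | rewrite yE dvdn_mull].
  by have := leq_mul al_le (leqnn m); lia.
have [w0|w_gt0] := posnP (width m i).
  have i_gt0 : 0 < i.
    by case: (i) w0 => //; rewrite /width divn1 => m0; rewrite m0 in m_gt0.
  have := err_run x y in_s; rewrite -/xf; have := err_y i_gt0; rewrite w0.
  by case: (err n xf y) => [|e]; rewrite ?muln0 //; lia.
(* Now [K] lies in the node, so at its left end the ones are the rarer strays, and at its right end
   the zeros. *)
have far b (f := if b then p else p + h + h) : strays b n x f <= err n x f.
  rewrite /f /err; case: b {f}; [have := bal x p | have := bal x (p + h + h)];
  by rewrite -/K; lia.
have errp0 b (f := if b then p else p + h + h) : 80 * 4 ^ i.+1 * err n x f <= al * m.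
  have dvd_p : m * 2 ^ i.+1 %| p by rewrite dvdn_mulr.
  apply: errx; rewrite /f; case: (b) => //; try lia.
  by rewrite -addnA dvdn_addr // expnS /h; apply/dvdnP; exists 1; lia.
suff [b main] : exists b,
    80 * err n xf y <= width m i + 80 * err n x (if b then p else p + h + h).
  have := leq_mul (leqnn (4 * 4 ^ i)) main; have := errp0 b.
  by have := leq_divM m (4 ^ i); rewrite -/(width m i) expnS; lia.
have splitting op k0 : k0 < 2 ^ r.+1 -> exists s1 s2,
    tree op m l 0 = s1 ++ tree op m i (h * k0) ++ s2.
  by move=> k0_lt; rewrite -irl; apply: tree_split.
have [f1 [f2 Ef]] : exists s1 s2, tree (collect false m) m l 0 =
    s1 ++ tree (collect false m) m i (p + h) ++ s2.
  by rewrite -yph yE mulnC; apply: splitting; rewrite kE expnS; lia.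
have [t1 [t2 Et]] : exists s1 s2, tree (collect true m) m l 0 =
    s1 ++ tree (collect true m) m i p ++ s2.
  have -> : p = h * k'.*2 by rewrite /p /h expnS; lia.
  by apply: splitting; rewrite expnS; lia.
have [e1 [e2 Ee]] : exists s1 s2, tree (exchange m) m l 0 =
    s1 ++ exchange m i p ++ s2.
  have [s1 [s2]] := @tree_split (exchange m) m r i.+1 0 k' k'_lt.
  rewrite addSnnS irl => ->; rewrite add0n -/p /=.
  exists (s1 ++ tree (exchange m) m i p ++ tree (exchange m) m i (p + h)), s2.
  by rewrite -!catA.
have := in_s; rewrite /sweep Ef Et Ee !inside_cat.
case/and3P => /and3P[inf1 infc inf2] /and3P[int1 intc int2] /and3P[ine1 ine ine2].
pose xe := run ((f1 ++ tree (collect false m) m i (p + h) ++ f2) ++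
  (t1 ++ tree (collect true m) m i p ++ t2) ++ e1) x.
(* The symbol rarer in the two zones just before the exchange decides which side is analysed. *)
have [few|many] := leqP (cnt false xe (p + h) (p + h + width m i))
    (cnt true xe (p + h - width m i) (p + h)).
  pose s2 := f2 ++ (t1 ++ tree (collect true m) m i p ++ t2) ++ e1.
  exists false; rewrite yph /xf.
  have -> : sweep m l = f1 ++ tree (collect false m) m i (p + h) ++ s2 ++
      exchange m i p ++ e2.
    by rewrite /sweep Ef Et Ee /s2; move: (exchange _ _ _) => s; rewrite -!catA.
  apply: (@exchange_side false j i l p x f1 s2 e2) => //.
  - by rewrite -/m -/h -yph.
  - by rewrite /s2 !inside_cat inf2 int1 intc int2 ine1.
  - by move: few; rewrite /xe /s2 -!catA.
pose s1 := (f1 ++ tree (collect false m) m i (p + h) ++ f2) ++ t1.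
exists true; rewrite yph /xf.
have -> : sweep m l = s1 ++ tree (collect true m) m i p ++ (t2 ++ e1) ++
    exchange m i p ++ e2.
  by rewrite /sweep Ef Et Ee /s1; move: (exchange _ _ _) => s; rewrite -!catA.
apply: (@exchange_side true j i l p x s1 (t2 ++ e1) e2) => //.
- by rewrite -/m -/h -yph.
- by rewrite /s1 !inside_cat inf1 infc inf2 int1.
- by rewrite inside_cat int2 ine1.
- by move: many => /ltnW; rewrite /xe /s1 -!catA.
Qed.

(** * Halving the cells down to single positions *)

Fixpoint levels k r :=
  if r is r'.+1 then
    levels k r' ++ sweep (2 ^ (k - r)) r ++ sweep (2 ^ (k - r)) r
  else [::].

Lemma levels_inside k r : r <= k -> inside 0 (2 ^ k) (levels k r).
Proof.
elim: r => // r IH r_lt /=.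
have := sweep_inside (2 ^ (k - r.+1)) r.+1; rewrite -expnD subnK //.
move: (sweep _ _) => s s_in; rewrite !inside_cat s_in IH //; exact: ltnW.
Qed.

(* Measuring [err] at scale [i] in units of [m / (80 * 4 ^ i)], the first sweep takes
   20 to 6, and the second one 6 to 5/2, which is 20 in the units of the next level. *)
Lemma levelsP k r x i y :
  r <= k -> i <= r -> 2 ^ (k - r) * 2 ^ i %| y -> y <= 2 ^ k ->
  32 * 4 ^ i * err (2 ^ k) (run (levels k r) x) y <= 2 ^ (k - r).
Proof.
elim: r i y => [|r IH] i y r_le.
  rewrite leqn0 => /eqP -> /=; rewrite subn0 muln1 => dvd_y le_y.
  suff -> : err (2 ^ k) x y = 0 by rewrite muln0.
  have [->|->] : y = 0 \/ y = 2 ^ k.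
    have := expn_gt0 2 k.
    by case/dvdnP: dvd_y le_y => [[|[|d]]] ->; rewrite ?mul0n ?mul1n;
      [left | right | lia].
  - by rewrite /err /strays /cnt (big_geq (leqnn 0)) minn0.
  - by rewrite /err /strays /cnt (big_geq (leqnn _)) min0n.
move=> le_ir dvd_y le_y; have -> : run (levels k r.+1) x =
    run (sweep (2 ^ (k - r.+1)) r.+1)
      (run (sweep (2 ^ (k - r.+1)) r.+1) (run (levels k r) x)).
  by rewrite /=; move: (sweep _ _) => s; rewrite !run_cat.
have nE : 2 ^ k = 2 ^ (k - r.+1) * 2 ^ r.+1 by rewrite -expnD subnK.
have mE : 2 ^ (k - r) = 2 * 2 ^ (k - r.+1) by rewrite -expnS subnSK.
set x' := run (levels k r) x.
have hyp0 i' y' : 0 < i' <= r.+1 -> 2 ^ (k - r.+1) * 2 ^ i' %| y' -> y' <= 2 ^ k ->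
    80 * 4 ^ i' * err (2 ^ k) x' y' <= 20 * 2 ^ (k - r.+1).
  case: i' => // i' /= le_i'r dvd_y' le_y'.
  have dvdE : 2 ^ (k - r) * 2 ^ i' = 2 ^ (k - r.+1) * 2 ^ i'.+1.
    by rewrite mE expnS; lia.
  have := IH i' y' (ltnW r_le) le_i'r; rewrite dvdE => /(_ dvd_y' le_y').
  by rewrite -/x' mE expnS; lia.
rewrite nE in hyp0.
have hyp1 i' y' := @sweepP (k - r.+1) r.+1 20 x' (leqnn 20) hyp0 i' y'.
have := @sweepP (k - r.+1) r.+1 6
  (run (sweep (2 ^ (k - r.+1)) r.+1) x') isT.
move=> /(_ _ i y le_ir dvd_y); rewrite -nE => main.
have {main} : 320 * 4 ^ i * err (2 ^ k) (run (sweep (2 ^ (k - r.+1)) r.+1)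
    (run (sweep (2 ^ (k - r.+1)) r.+1) x')) y <= (6 + 4) * 2 ^ (k - r.+1).
  apply: main => // i' y' /andP[_ le_i'r] dvd_y' le_y'.
  by have := hyp1 i' y' le_i'r dvd_y'; rewrite -nE => /(_ le_y'); lia.
by lia.
Qed.

(** For cells of size 1, scale 0 gives [32 * err <= 1], so no cut has an error, whereas an inversion
    [i < j] causes one at the cut [j]. *)
Lemma levels_sorted k x i j : i < j < 2 ^ k ->
  run (levels k k) x i ==> run (levels k k) x j.
Proof.
case/andP=> lt_ij j_lt; apply/implyP; apply: contraLR => xj; apply/negP => xi.
have := @levelsP k k x 0 j (leqnn k) isT; rewrite subnn !expn0 !muln1 dvd1n.
move=> /(_ isT (ltnW j_lt)); suff : 0 < err (2 ^ k) (run (levels k k) x) j by lia.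
rewrite leq_min; apply/andP; split.
  by rewrite /strays /cnt big_ltn // (negPf xj).
rewrite /strays (@cnt_split _ _ 0 i j); last by rewrite (ltnW lt_ij).
by rewrite /cnt [X in _ + X]big_ltn // xi addnCA.
Qed.

Lemma size_oriented_halvers b q v z gs : 1 < q ->
  size (flatten [seq oriented_halver b q v z g | g <- gs]) <= size gs * (8 * q ^ 2 * v).
Proof.
move=> q_gt1; elim: gs => //= g gs IH; rewrite size_cat mulSn leq_add //.
by rewrite /oriented_halver; case: b {IH}; apply: size_halver.
Qed.

Lemma quality_width m i v : v <= width m i ->
  8 * quality i ^ 2 * v <= 8 * q0 ^ 2 * m.
Proof.
move=> v_le; rewrite /quality expnMn -(expnM 2) (mulnC i) (expnM 2 2).
have le_m : 4 ^ i * v <= m.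
  apply: leq_trans (leq_divM m (4 ^ i)); rewrite [leqRHS]mulnC.
  by rewrite leq_mul2l v_le orbT.
by have := leq_mul (leqnn (8 * q0 ^ 2)) le_m; rewrite !mulnA.
Qed.

(** Per node, two collections of seven halvers and one exchange: [2 * 56 + 8 = 120]. *)
Lemma size_sweep m l : size (sweep m l) <= 120 * q0 ^ 2 * (m * 2 ^ l).
Proof.
have col b i p : size (collect b m i p) <= 56 * q0 ^ 2 * m.
  apply: leq_trans (size_oriented_halvers _ _ _ _ (quality_gt1 i)) _.
  have -> : size (chunks b m i p) = 7 by rewrite /chunks; case: b.
  have : width m i.+1 <= width m i by have := widthS_le m i; lia.
  by move/quality_width; lia.
have exc i p : size (exchange m i p) <= 8 * q0 ^ 2 * m.
  apply: leq_trans (size_halver _ _ _ (quality_gt1 i)) _.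
  exact: quality_width.
rewrite /sweep !size_cat.
have := size_tree m l 0 (col false); have := size_tree m l 0 (col true).
by have := size_tree m l 0 exc; lia.
Qed.

Lemma size_levels k r : r <= k -> size (levels k r) <= 240 * q0 ^ 2 * (r * 2 ^ k).
Proof.
elim: r => // r IH r_lt /=.
have := IH (ltnW r_lt); have := size_sweep (2 ^ (k - r.+1)) r.+1.
by move: (sweep _ _) => s; rewrite -expnD subnK // !size_cat; lia.
Qed.
End Sweeps.

(** * Arbitrary lengths and arbitrary orders *)

Lemma restrict_inside n m s : inside 0 m s -> inside 0 n [seq c <- s | c.2 < n].
Proof.
move=> /allP ins; apply/allP => c; rewrite mem_filter => /andP[c2 /ins]; lia.
Qed.

(** Positions from [n] on are padded with ones, and a comparator whose maximum side already carries
    a one does nothing. *)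
Lemma run_restrict n m s x : inside 0 m s -> (forall k, n <= k -> x k) ->
  run [seq c <- s | c.2 < n] x =1 run s x.
Proof.
elim: s x => //= c s IH x /andP[c_lt ins] ones k.
case: ifP => c2 /=.
  apply: IH => // l nl; rewrite /compare; case: eqP => [lc|_]; first by lia.
  by case: eqP => [lc|_]; [lia|exact: ones].
rewrite IH //; congr (run _ _ k); apply: funext => l; rewrite /compare.
have x2 : x c.2 by apply: ones; lia.
case: eqP => [->|_]; first by rewrite x2; case: (x _).
by case: eqP => [->|_] //; rewrite x2; case: (x _).
Qed.

Lemma eq_run_inside n s x y : inside 0 n s -> (forall k, k < n -> x k = y k) ->
  forall k, k < n -> run s x k = run s y k.
Proof.
elim: s x y => //= c s IH x y /andP[c_lt ins] xy; apply: IH => // k k_lt.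
by rewrite /compare !xy //; lia.
Qed.

End ZeroOneNetworks.

Theorem sorting_network : exists C, forall n, exists s,
  [/\ inside 0 n s, size s <= C * (up_log 2 n * 2 ^ up_log 2 n)
    & forall d (T : orderType d) (x : nat -> T) i j, i < j < n ->
        (run s x i <= run s x j)%O].
Proof.
pose q0 := 2320; exists (240 * q0 ^ 2) => n.
(* From here on only [2320 <= q0] is known, so that no tactic computes with the numeral. *)
have := leqnn q0; rewrite {1}/q0; move: q0 => q0 q0_ge.
set k := up_log 2 n; have n_le : n <= 2 ^ k by exact: up_logP.
have ins := levels_inside q0_ge (leqnn k).
exists [seq c <- levels q0 k k | c.2 < n]; split.
- exact: restrict_inside ins.
- rewrite size_filter; apply: leq_trans (count_size _ _) _.
  exact: size_levels.
move=> d T x i j ij; rewrite leNgt; apply/negP => lt_ji.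
(* Zero-one principle: the threshold at the output [j] turns the alleged disorder into a one at [i]
   and a zero at [j]. *)
set s := [seq c <- _ | _] in lt_ji; pose f t := (run s x j < t)%O.
have f_homo : {homo f : a b / (a <= b)%O}.
  move=> a a' le_aa'; rewrite /f /=; case: ltP => //= lt.
  by rewrite (lt_le_trans lt le_aa').
pose y l := if l < n then f (x l) else true.
have E l : l < n -> f (run s x l) = run (levels q0 k k) y l.
  move=> l_lt; rewrite -(@run_restrict n (2 ^ k)) //; last first.
    by move=> l' nl'; rewrite /y ltnNge nl'.
  rewrite -[LHS]/((f \o run s x) l) -(run_homo s x f_homo).
  apply: (@eq_run_inside n) => //; first exact: restrict_inside ins.
  by move=> l' l'_lt; rewrite /y l'_lt.
have := @levels_sorted q0 q0_ge k y i j; rewrite -!E; try lia.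
by rewrite /f ltxx lt_ji => /(_ _); lia.
Qed.

(** * Polytopes and extended formulations *)

Local Open Scope classical_set_scope.
Local Open Scope ring_scope.

(** * Convex hulls and vertices of polytopes *)

Section Convexity.
Variables (R : realType) (n : nat).
Implicit Types (A P Q : set 'cV[R]_n) (x y z : 'cV[R]_n).

Lemma convex_setE A : @convex_set R 'cV[R]_n A <->
  forall x y (t : R), 0 <= t <= 1 -> A x -> A y -> A (t *: x + (1 - t) *: y).
Proof.
split=> [cA x y t /andP[t0 t1] Ax Ay|cA x y t].
  exact: set_mem (cA x y (Itv01 t0 t1) (mem_set Ax) (mem_set Ay)).
move=> /set_mem Ax /set_mem Ay; apply/mem_set/cA => //.
by apply/andP; split; [exact: ge0 | exact: le1].
Qed.

Lemma convex_conv_hull (S : set 'cV[R]_n) : @convex_set R 'cV[R]_n (conv_hull S).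
Proof.
apply/convex_setE => x y t t01 Sx Sy Q [Qc SQ].
by move/convex_setE: (Qc); apply=> //; [exact: Sx|exact: Sy].
Qed.

Lemma conv_hull_sub (S Q : set 'cV[R]_n) :
  @convex_set R 'cV[R]_n Q -> S `<=` Q -> conv_hull S `<=` Q.
Proof. by move=> Qc SQ; apply: smallest_sub. Qed.

Lemma sub_conv_hull (S : set 'cV[R]_n) : S `<=` conv_hull S.
Proof. exact: sub_gen_smallest. Qed.

Lemma dotDr (c x y : 'cV[R]_n) : dot c (x + y) = dot c x + dot c y.
Proof. by rewrite /dot -big_split /=; apply: eq_bigr => i _; rewrite mxE mulrDr. Qed.

Lemma dotZr (c x : 'cV[R]_n) a : dot c (a *: x) = a * dot c x.
Proof. by rewrite /dot big_distrr /=; apply: eq_bigr => i _; rewrite mxE mulrCA. Qed.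

Lemma dotBr (c x y : 'cV[R]_n) : dot c (x - y) = dot c x - dot c y.
Proof. by rewrite -scaleN1r dotDr dotZr mulN1r. Qed.

Lemma dotDl (c c' x : 'cV[R]_n) : dot (c + c') x = dot c x + dot c' x.
Proof. by rewrite /dot -big_split /=; apply: eq_bigr => i _; rewrite mxE mulrDl. Qed.

Lemma dotZl (c x : 'cV[R]_n) a : dot (a *: c) x = a * dot c x.
Proof. by rewrite /dot big_distrr /=; apply: eq_bigr => i _; rewrite mxE mulrA. Qed.

Lemma exists_between (T : eqType) (s : seq T) (f : T -> R) (u : R) :
  (forall i, i \in s -> f i < u) -> exists2 t, t < u & forall i, i \in s -> f i < t.
Proof.
elim: s => [_|i s IH fu]; first by exists (u - 1) => //; lra.
have [|t tu ft] := IH; first by move=> j js; apply: fu; rewrite inE js orbT.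
have fiu : f i < u by apply: fu; rewrite inE eqxx.
exists (Num.max t ((f i + u) / 2)); first by rewrite gt_max tu /=; lra.
move=> j; rewrite inE => /predU1P[->|/ft ftj]; rewrite lt_max ?ftj //.
by apply/orP; right; lra.
Qed.

Lemma exists_upper (T : eqType) (s : seq T) (f : T -> R) :
  exists t, forall i, i \in s -> f i < t.
Proof.
elim: s => [|i s [t ft]]; first by exists 0.
exists (Num.max t (f i + 1)) => j; rewrite inE lt_max => /predU1P[->|/ft -> //].
by rewrite ltrDl ltr01 orbT.
Qed.

Lemma dot_gt0 (x : 'cV[R]_n) : x != 0 -> 0 < dot x x.
Proof.
move=> x_neq0; rewrite lt0r /dot sumr_ge0 ?andbT; last first.
  by move=> i _; rewrite -expr2 sqr_ge0.
apply: contraNneq x_neq0 => /eqP; rewrite psumr_eq0 => [/allP x0|i _]; last first.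
  by rewrite -expr2 sqr_ge0.
apply/eqP/colP => i; rewrite mxE; apply/eqP.
by have := x0 i (mem_index_enum i); rewrite -expr2 sqrf_eq0.
Qed.

(* Gordan's alternative, by eliminating one vector at a time. *)
Lemma gordan (T : eqType) (s : seq T) (v : T -> 'cV[R]_n) : uniq s ->
  (exists c, forall i, i \in s -> 0 < dot c (v i)) \/
  (exists l : T -> R, [/\ forall i, i \in s -> 0 <= l i,
     0 < \sum_(i <- s) l i & \sum_(i <- s) l i *: v i = 0]).
Proof.
elim: s v => [|k s IH] v /=; first by left; exists 0.
case/andP=> kNs s_uniq; have [s0|s_neq0] := eqVneq s [::].
  rewrite s0; have [vk0|vk_neq0] := eqVneq (v k) 0.
    right; exists (fun=> 1); split=> //; rewrite big_seq1 ?vk0 ?scaler0 //.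
  by left; exists (v k) => i; rewrite inE => /eqP ->; apply: dot_gt0.
have eq_s (f g : T -> R) (F : T -> R -> 'cV[R]_n) : {in s, f =1 g} ->
    \sum_(i <- s) F i (f i) = \sum_(i <- s) F i (g i).
  by move=> fg; apply: eq_big_seq => i /fg ->.
have [[c c_pos]|[l [l_ge0 l_pos l_eq]]] := IH v s_uniq; last first.
  right; exists (fun i => if i == k then 0 else l i); rewrite !big_cons eqxx.
  have E : {in s, (fun i => if i == k then 0 else l i) =1 l}.
    by move=> i i_s /=; case: eqP => // ik; rewrite -ik i_s in kNs.
  split.
  - by move=> i; rewrite inE; case: eqP => //= _ /l_ge0.
  - by rewrite add0r (eq_big_seq l).
  - by rewrite scale0r add0r (eq_s _ _ (fun i a => a *: v i) E).
have [ck_gt0|ck_le0] := ltP 0 (dot c (v k)).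
  by left; exists c => i; rewrite inE => /predU1P[->|/c_pos].
(* The vectors [al i *: v k + ga *: v i] are nonnegative combinations orthogonal to [c]. A vanishing
   combination of them is one of the original vectors; a direction [c'] positive on them is
   corrected by a multiple of [c]. *)
pose al i := dot c (v i); pose ga := - dot c (v k).
have ga_ge0 : 0 <= ga by rewrite oppr_ge0.
have [[c' c'_pos]|[l [l_ge0 l_pos l_eq]]] :=
    IH (fun i => al i *: v k + ga *: v i) s_uniq; last first.
  right; exists (fun i => if i == k then \sum_(i <- s) l i * al i else ga * l i).
  have E : {in s, (fun i => if i == k then \sum_(i <- s) l i * al i else ga * l i)
      =1 (fun i => ga * l i)}.
    by move=> i i_s /=; case: eqP => // ik; rewrite -ik i_s in kNs.
  rewrite !big_cons eqxx (eq_big_seq _ E) (eq_s _ _ (fun i a => a *: v i) E).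
  have la_ge0 i : i \in s -> 0 <= l i * al i.
    by move=> i_s; rewrite mulr_ge0 ?l_ge0 // ltW ?c_pos.
  have la_sum : 0 <= \sum_(i <- s) l i * al i by rewrite big_seq; apply: sumr_ge0.
  split.
  - move=> i; rewrite inE; case: eqP => [//|_ /= i_s].
    by rewrite mulr_ge0 ?l_ge0.
  - rewrite ltr_pwDl //; last first.
      by rewrite big_seq; apply: sumr_ge0 => i i_s; rewrite mulr_ge0 ?l_ge0.
    rewrite lt0r la_sum andbT; apply: contraTneq l_pos => /eqP.
    rewrite big_seq psumr_eq0 // => /allP l0; rewrite big_seq big1 ?ltxx // => i i_s.
    have := l0 i i_s; rewrite i_s /= mulf_eq0 => /orP[/eqP //|].
    by rewrite gt_eqF // c_pos.
  - rewrite -[RHS]l_eq scaler_suml -big_split /=; apply: eq_bigr => i _.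
    by rewrite scalerDr !scalerA [ga * _]mulrC.
left; have c'_pos' i : i \in s -> - dot c' (v i) * ga < dot c' (v k) * al i.
  move=> /c'_pos; rewrite dotDr !dotZr; lra.
have al_pos i : i \in s -> 0 < al i by move/c_pos.
pose f i := - dot c' (v i) / al i.
(* The multiple must be large enough for every [v i] yet keep [v k] positive. The choice of [c']
   leaves room for that; if [ga = 0], the correction does not affect [v k]. *)
have [t ft ftk] : exists2 t, forall i, i \in s -> f i < t & 0 < dot c' (v k) - t * ga.
  have [ga0|ga_neq0] := eqVneq ga 0.
    have [t ft] := exists_upper s f; exists t => //.
    rewrite ga0 mulr0 subr0.
    have [i i_s] : exists i, i \in s.
      by case: (s) s_neq0 => // i s' _; exists i; rewrite inE eqxx.
    by have := c'_pos' i i_s; rewrite ga0 mulr0 pmulr_lgt0 ?al_pos.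
  have ga_gt0 : 0 < ga by rewrite lt0r ga_neq0.
  have [i i_s|t tu ft] := @exists_between _ s f (dot c' (v k) / ga).
    by rewrite ltr_pdivrMr ?al_pos // mulrAC ltr_pdivlMr // c'_pos'.
  by exists t => //; rewrite subr_gt0 -ltr_pdivlMr.
exists (c' + t *: c) => i; rewrite inE dotDl dotZl => /predU1P[->|i_s].
  by move: ftk; rewrite /ga; lra.
have := ft i i_s; rewrite /f ltr_pdivrMr ?al_pos // /al; lra.
Qed.

Lemma convex_sum (T : eqType) (s : seq T) (l : T -> R) (v : T -> 'cV[R]_n) A :
  @convex_set R 'cV[R]_n A -> (forall i, i \in s -> 0 <= l i) ->
  (forall i, i \in s -> A (v i)) -> 0 < \sum_(i <- s) l i ->
  A ((\sum_(i <- s) l i)^-1 *: \sum_(i <- s) l i *: v i).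
Proof.
move=> Ac; elim: s => [|k s IH] l_ge0 Av; first by rewrite big_nil ltxx.
have lk_ge0 : 0 <= l k by rewrite l_ge0 ?inE ?eqxx.
have Avk : A (v k) by apply: Av; rewrite inE eqxx.
have ls_ge0 i : i \in s -> 0 <= l i by move=> i_s; rewrite l_ge0 // inE i_s orbT.
rewrite !big_cons; set L := \sum_(i <- s) l i; set V := \sum_(i <- s) _ => L_gt0.
have L_ge0 : 0 <= L by rewrite /L big_seq sumr_ge0.
have [L0|L_neq0] := eqVneq L 0.
  have l0 : {in s, forall i, l i = 0}.
    move=> i i_s; move/eqP: L0; rewrite /L big_seq psumr_eq0 // => /allP /(_ i i_s).
    by rewrite i_s => /eqP.
  have -> : V = 0 by rewrite /V big_seq big1 // => i /l0 ->; rewrite scale0r.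
  move: L_gt0; rewrite L0 !addr0 => lk_gt0.
  by rewrite scalerA mulVf ?scale1r // gt_eqF.
have {}IH : A (L^-1 *: V).
  apply: IH => //; last by rewrite lt0r L_neq0.
  by move=> i i_s; apply: Av; rewrite inE i_s orbT.
move/convex_setE: Ac => /(_ (v k) (L^-1 *: V) (l k / (l k + L)) _ Avk IH).
rewrite divr_ge0 ?ler_pdivrMr ?mul1r ?lerDl ?addr_ge0 //= => /(_ L_ge0).
congr (A _); rewrite scalerDr !scalerA mulrC; congr (_ + _ *: _).
by rewrite mulrC; field; rewrite L_neq0 gt_eqF.
Qed.

(** Redundant generators are dropped one by one. Once none is redundant, Gordan's alternative for
    the differences [a - y] yields either a functional maximal at the generator [a] alone, so that
    [a] is a vertex, or [a] as a convex combination of the others, which is excluded. *)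
Lemma polytope_vertices P Q : polytope P -> @convex_set R 'cV[R]_n Q ->
  (forall v, is_vertex P v -> Q v) -> P `<=` Q.
Proof.
move=> [S /finite_seqP[s ->] {S} ->] Qc.
have -> : [set` s] = [set` undup s] by apply/seteqP; split=> z /=; rewrite mem_undup.
have [N] := ubnP (size (undup s)); move: (undup s) (undup_uniq s) => {}s.
elim: N s => // N IH s s_uniq; rewrite ltnS => size_s Qv.
have [[a a_s red]|irred] :=
    pselect (exists2 a, a \in s & conv_hull [set` rem a s] a).
  have convE : conv_hull [set` s] = conv_hull [set` rem a s].
    apply/seteqP; split; apply: conv_hull_sub; try exact: convex_conv_hull.
      move=> y /= y_s; have [->//|ya] := eqVneq y a.
      by apply: sub_conv_hull; rewrite /= (mem_rem_uniq a s_uniq) inE ya.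
    by move=> y /= /mem_rem y_s; apply: sub_conv_hull.
  rewrite convE in Qv *; apply: IH => //; first exact: rem_uniq.
  by rewrite size_rem // prednK //; case: (s) a_s.
apply: conv_hull_sub => // a a_s; apply: Qv.
have [[c c_pos]|[l [l_ge0 l_pos l_eq]]] :=
  gordan (fun y => a - y) (rem_uniq a s_uniq); last first.
  exfalso; apply: irred; exists a => //.
  have aE : a = (\sum_(i <- rem a s) l i)^-1 *: \sum_(i <- rem a s) l i *: i.
    apply: (scalerI (lt0r_neq0 l_pos)); rewrite scalerA mulfV ?gt_eqF // scale1r.
    apply/eqP; rewrite -subr_eq0; apply/eqP; rewrite scaler_suml -sumrB -[RHS]l_eq.
    by apply: eq_bigr => i _; rewrite scalerBr.
  rewrite [X in conv_hull _ X]aE.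
  apply: (@convex_sum _ (rem a s) l id (conv_hull [set` rem a s])) => //.
    exact: convex_conv_hull.
  by move=> i i_s; apply: sub_conv_hull.
have below : conv_hull [set` s] `<=` [set x | dot c x < dot c a \/ x = a].
  apply: conv_hull_sub => [|y /= y_s].
    apply/convex_setE => x y t /andP[t0 t1].
    have [->|t_neq0] := eqVneq t 0; first by rewrite scale0r subr0 scale1r add0r.
    have [->|t_neq1] := eqVneq t 1; first by rewrite scale1r subrr scale0r addr0.
    have t_gt0 : 0 < t by rewrite lt0r t_neq0.
    have t_lt1 : 0 < 1 - t by rewrite subr_gt0 lt_neqAle t_neq1.
    have scaled u z : 0 < u -> dot c z < dot c a -> u * dot c z < u * dot c a.
      by move=> u_gt0; rewrite ltr_pM2l.
    rewrite /= dotDr !dotZr => -[dx|->] [dy|->].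
    - by left; have := scaled t x t_gt0 dx; have := scaled (1 - t) y t_lt1 dy; lra.
    - by left; have := scaled t x t_gt0 dx; lra.
    - by left; have := scaled (1 - t) y t_lt1 dy; lra.
    - by right; rewrite -scalerDl addrC subrK scale1r.
  have [->|ya] := eqVneq y a; [by right|left].
  by rewrite -subr_gt0 -dotBr c_pos // (mem_rem_uniq a s_uniq) inE ya.
exists c, (dot c a); split=> [x /below [/ltW//|->//]|].
apply/seteqP; split=> [x -> /=|x /= [/below[lt_xa|//] xa]].
  by split=> //; apply: sub_conv_hull.
by rewrite xa ltxx in lt_xa.
Qed.
End Convexity.

(** * Comparators run backwards *)

Section ExtendedFormulations.
Variables (R : realType) (n : nat).
Implicit Types (P Q : set 'cV[R]_n) (x y z : 'cV[R]_n) (c : 'I_n * 'I_n).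

Lemma extended_formulation_convex P d f :
  has_extended_formulation P d f -> @convex_set R 'cV[R]_n P.
Proof.
move=> [m [A [b [E [e [p <-]]]]]]; apply/convex_setE => x1 x2 t /andP[t0 t1].
move=> [y [Ay Ey] <-] [z [Az Ez] <-]; exists (t *: y + (1 - t) *: z).
  split=> [i|]; last first.
    by rewrite mulmxDr -!scalemxAr Ey Ez -scalerDl addrC subrK scale1r.
  rewrite mulmxDr -!scalemxAr mxE [X in X + _]mxE [X in _ + X]mxE.
  have t1' : 0 <= 1 - t by rewrite subr_ge0.
  by have := ler_wpM2l t0 (Ay i); have := ler_wpM2l t1' (Az i); lra.
by rewrite linearD !linearZ.
Qed.

(* The comparator run backwards, with the outputs [z] relaxed to be at least as
   far apart as the inputs [x]. *)
Definition relax c P : set 'cV[R]_n := [set x | exists2 z, P z &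
  [/\ z c.1 0 <= x c.1 0, x c.1 0 <= z c.2 0,
      x c.1 0 + x c.2 0 = z c.1 0 + z c.2 0 &
      forall k, k != c.1 -> k != c.2 -> x k 0 = z k 0]].

(** The new variable is the coordinate [x c.1]; the coordinate [x c.2] is eliminated by the equality
    of sums. The rows of [A2] are the two new inequalities. *)
Lemma extended_formulation_relax c P d f : c.1 != c.2 ->
  has_extended_formulation P d f ->
  has_extended_formulation (relax c P) (d + 1) (f + 2).
Proof.
case: c => i j /= ij [m [A [b [E [e [p <-]]]]]].
pose M := \matrix_(k < n, l < d) p (delta_mx l 0) k 0.
have pE u k : p u k 0 = \sum_l M k l * u l 0.
  rewrite [u in LHS]matrix_sum_delta linear_sum summxE; apply: eq_bigr => l _.
  by rewrite big_ord1 linearZ !mxE mulrC.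
pose A2 := row_mx (\matrix_(r < 2, l < d) (if r == 0 then M i l else - M j l))
  (\col_(r < 2) (if r == 0 then -1 else 1 : R)) : 'M_(2, d + 1).
pose M' := row_mx (\matrix_(k < n, l < d)
    (if k == i then 0 else if k == j then M i l + M j l else M k l))
  (\col_(k < n) (if k == i then 1 else if k == j then -1 else 0 : R)) : 'M_(n, d + 1).
have A2E u (v : 'cV_1) r : (A2 *m col_mx u v) r 0 =
    if r == 0 then p u i 0 - v 0 0 else v 0 0 - p u j 0.
  rewrite mul_row_col !mxE big_ord1 !mxE !pE; case: ifP => r0.
    by rewrite mulN1r; congr (_ - _); apply: eq_bigr => l _; rewrite !mxE r0.
  rewrite mul1r addrC -sumrN; congr (_ + _); apply: eq_bigr => l _.
  by rewrite !mxE r0 mulNr.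
have M'E u (v : 'cV_1) k : (M' *m col_mx u v) k 0 =
    if k == i then v 0 0 else if k == j then p u i 0 + p u j 0 - v 0 0 else p u k 0.
  rewrite mul_row_col !mxE big_ord1 !mxE !pE; case: ifP => [ki|ki].
    by rewrite mul1r big1 ?add0r // => l _; rewrite !mxE ki mul0r.
  case: ifP => kj.
    rewrite mulN1r -big_split /=; congr (_ - _); apply: eq_bigr => l _.
    by rewrite !mxE ki kj mulrDl.
  by rewrite mul0r addr0; apply: eq_bigr => l _; rewrite !mxE ki kj.
exists m, (col_mx (row_mx A 0) A2), (col_mx b 0), (row_mx E 0), e.
exists (mulmx M' : {linear 'cV_(d + 1) -> 'cV_n}).
apply/seteqP; split=> [_ [w [Aw Ew] <-]|x [z [u [Au Eu] <-] [zx xz sum_x rest]]].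
  rewrite -[w]vsubmxK in Aw Ew *.
  set u := usubmx w in Aw Ew *; set v := dsubmx w in Aw Ew *.
  exists (p u).
    exists u => //; split=> [r|].
      have := Aw (lshift 2 r); rewrite mul_col_mx !col_mxEu mul_row_col mul0mx addr0.
      by [].
    by rewrite mul_row_col mul0mx addr0 in Ew.
  have /= := Aw (rshift f 0).
  rewrite mul_col_mx !col_mxEd A2E [X in _ <= X]mxE /= => le_i.
  have /= := Aw (rshift f 1).
  rewrite mul_col_mx !col_mxEd A2E [X in _ <= X]mxE /= => le_j.
  rewrite /= !M'E !eqxx [j == i]eq_sym (negPf ij); split; [lra|lra|lra|].
  by move=> k ki kj; rewrite M'E (negPf ki) (negPf kj).
exists (col_mx u (x i 0)%:M).
  split=> [r|]; last by rewrite mul_row_col mul0mx addr0.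
  rewrite mul_col_mx; case: (splitP r) => r' rE.
    rewrite (_ : r = lshift 2 r'); last exact: val_inj.
    by rewrite !col_mxEu mul_row_col mul0mx addr0.
  rewrite (_ : r = rshift f r'); last exact: val_inj.
  rewrite !col_mxEd A2E !mxE /= ?eqxx ?mulr1n; case: ifP => _; rewrite subr_le0 //.
apply/colP => k; rewrite /= M'E !mxE ?eqxx ?mulr1n.
case: eqP => [->//|/eqP ki]; case: eqP => [->|/eqP kj]; last by rewrite rest.
by move: sum_x => /= <-; rewrite addrC addKr.
Qed.

Definition unsort (s : seq ('I_n * 'I_n)) P := foldr relax P s.

Lemma extended_formulation_unsort s P d f : all (fun c => c.1 != c.2) s ->
  has_extended_formulation P d f ->
  has_extended_formulation (unsort s P) (d + size s) (f + 2 * size s).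
Proof.
move=> + Pdf; elim: s => [_|c s IH] /=; first by rewrite muln0 !addn0.
move=> /andP[c_neq /IH{}IH]; rewrite mulnS -addn1 addnA [(2 + _)%N]addnC addnA.
exact: extended_formulation_relax.
Qed.

Definition permute (g : 'S_n) x : 'cV[R]_n := \col_k x (g k) 0.

Lemma permute_comb g x y t :
  permute g (t *: x + (1 - t) *: y) = t *: permute g x + (1 - t) *: permute g y.
Proof. by apply/colP => k; rewrite !mxE. Qed.

Lemma permuteM g h x : permute g (permute h x) = permute (g * h)%g x.
Proof. by apply/colP => k; rewrite !mxE permM. Qed.

Lemma reflection_permute k l : k != l ->
  reflection (delta_mx k 0 - delta_mx l 0) = permute (tperm k l).
Proof.
move=> kl; apply: funext => x.
have dotE y : dot (delta_mx k 0 - delta_mx l 0) y = y k 0 - y l 0.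
  rewrite /dot (bigD1 k) //= (bigD1 l) 1?eq_sym //= big1 => [|i /andP[ik il]].
    by rewrite !mxE !eqxx (negPf kl) eq_sym (negPf kl) /=; lra.
  by rewrite !mxE (negPf ik) (negPf il) /= subrr mul0r.
apply/colP => i.
rewrite /reflection !dotE !mxE !eqxx (negPf kl) eq_sym (negPf kl) /= andbT andbT.
case: tpermP => [->|->|/eqP/negPf ik /eqP/negPf il].
- by rewrite eqxx (negPf kl) /=; field.
- by rewrite eqxx eq_sym (negPf kl) /=; field.
- by rewrite ik il /= subrr mulr0 subr0.
Qed.

Lemma group_A_permute g : group_A R n g -> exists h : 'S_n, g = permute h.
Proof.
elim=> [|a {}g [k [l [kl ->]]] _ [h ->]].
  by exists 1%g; apply: funext => x; apply/colP => k; rewrite !mxE perm1.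
exists (tperm k l * h)%g; apply: funext => x /=.
by rewrite reflection_permute // permuteM.
Qed.

Lemma permutahedron_convex G P : @convex_set R 'cV[R]_n (permutahedron G P).
Proof. exact: convex_conv_hull. Qed.

Lemma sub_permutahedron P : P `<=` permutahedron (group_A R n) P.
Proof.
move=> x Px; apply: sub_conv_hull; exists id; first exact: reflection_group_id.
by exists x.
Qed.

Lemma permutahedron_tperm P k l x : k != l ->
  permutahedron (group_A R n) P x ->
  permutahedron (group_A R n) P (permute (tperm k l) x).
Proof.
move=> kl; move: x; apply: (@conv_hull_sub R n _
  [set x | permutahedron (group_A R n) P (permute (tperm k l) x)]).
  apply/convex_setE => y z t t01 /= Py Pz; rewrite permute_comb.
  by move/convex_setE: (@permutahedron_convex (group_A R n) P); apply.
move=> _ [g Gg [y Py <-]]; apply: sub_conv_hull; exists (permute (tperm k l) \o g).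
  rewrite -reflection_permute //; apply: reflection_group_comp => //.
  by exists k, l.
by exists y.
Qed.

(** A relaxed point lies on the segment from [z] to its image under the transposition. *)
Lemma relax_permutahedron c P Q : c.1 != c.2 ->
  Q `<=` permutahedron (group_A R n) P ->
  relax c Q `<=` permutahedron (group_A R n) P.
Proof.
case: c => i j /= ij QP x [z /QP Pz] /= [zx xz sum_x rest].
have Pz' := permutahedron_tperm ij Pz.
have [zz|zz] := eqVneq (z i 0) (z j 0).
  suff -> : x = z by [].
  apply/colP => k; have [->|ki] := eqVneq k i; first by lra.
  by have [->|kj] := eqVneq k j; [lra | exact: rest].
have zij : 0 < z j 0 - z i 0 by rewrite subr_gt0 lt_neqAle zz (le_trans zx).
pose t := (z j 0 - x i 0) / (z j 0 - z i 0).
suff -> : x = t *: z + (1 - t) *: permute (tperm i j) z.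
  move/convex_setE: (@permutahedron_convex (group_A R n) P); apply=> //.
  by rewrite /t divr_ge0 ?ler_pdivrMr //=; lra.
apply/colP => k; rewrite !mxE; case: tpermP => [->|->|/eqP ki /eqP kj].
- by rewrite /t; field; rewrite gt_eqF.
- have -> : x j 0 = z i 0 + z j 0 - x i 0 by lra.
  by rewrite /t; field; rewrite gt_eqF.
- by rewrite rest //; lra.
Qed.

Lemma unsort_permutahedron s P : all (fun c => c.1 != c.2) s ->
  unsort s P `<=` permutahedron (group_A R n) P.
Proof.
elim: s => [_|c s IH] /=; first exact: sub_permutahedron.
by case/andP=> c_neq /IH; apply: relax_permutahedron.
Qed.

Lemma perm_map_permute g x :
  perm_eq [seq permute g x j 0 | j <- enum 'I_n] [seq x j 0 | j <- enum 'I_n].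
Proof.
under eq_map do rewrite mxE.
rewrite (map_comp (fun j => x j 0) g); apply: perm_map; apply: uniq_perm.
- by rewrite map_inj_uniq ?enum_uniq //; exact: perm_inj.
- exact: enum_uniq.
move=> k; rewrite mem_enum; apply/mapP; exists ((g^-1)%g k); rewrite ?mem_enum //.
by rewrite permKV.
Qed.

Lemma sort_vec_permute g x : sort_vec (permute g x) = sort_vec x.
Proof.
apply/colP => k; rewrite !mxE; congr (nth 0 _ k).
apply/perm_sortP; last exact: perm_map_permute.
- exact: le_total.
- exact: le_trans.
- exact: le_anti.
Qed.

Lemma sort_vec_sorted x : (forall i j : 'I_n, (i < j)%N -> x i 0 <= x j 0) ->
  sort_vec x = x.
Proof.
move=> x_sorted; apply/colP => k; rewrite mxE sorted_sort; last 2 first.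
- exact: le_trans.
- have : sorted ltn [seq val i | i <- enum 'I_n].
    by rewrite val_enum_ord iota_ltn_sorted.
  by rewrite !sorted_map; apply: sub_sorted => i j; apply: x_sorted.
by rewrite (nth_map k) ?size_enum_ord // nth_ord_enum.
Qed.

(** Expressed by a transposition, so that a run is visibly a permutation of its input. *)
Definition compare_vec c x : 'cV[R]_n :=
  if x c.1 0 <= x c.2 0 then x else permute (tperm c.1 c.2) x.

Definition run_vec (s : seq ('I_n * 'I_n)) x :=
  foldl (fun y c => compare_vec c y) x s.

Lemma run_vec_permute s x : exists g, run_vec s x = permute g x.
Proof.
elim: s x => [|c s IH] x /=.
  by exists 1%g; apply/colP => k; rewrite mxE perm1.
have [g ->] := IH (compare_vec c x); rewrite /compare_vec.
case: ifP => _; first by exists g.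
by exists (g * tperm c.1 c.2)%g; rewrite permuteM.
Qed.

Lemma run_vec_unsort s P x : P (run_vec s x) -> unsort s P x.
Proof.
elim: s x => //= c s IH x /IH {}IH; exists (compare_vec c x) => //.
rewrite /compare_vec; case: (leP (x c.1 0) (x c.2 0)) => [le_x|/ltW le_x].
  by split; rewrite ?lexx.
rewrite !mxE tpermL tpermR; split=> //; first by rewrite addrC.
by move=> k kc1 kc2; rewrite mxE tpermD 1?eq_sym.
Qed.

Lemma run_vecE s (x : 'cV[R]_n) (y : nat -> R) : all (fun c => c.1 != c.2) s ->
  (forall k : 'I_n, y k = x k 0) ->
  forall k : 'I_n, run [seq (val c.1, val c.2) | c <- s] y k = run_vec s x k 0.
Proof.
elim: s x y => //= c s IH x y /andP[c_neq /IH{}IH] yx; apply: IH => k.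
rewrite /compare /compare_vec /= !val_eqE !yx.
case: (leP (x c.1 0) (x c.2 0)) => le_c.
  by case: eqP => [->//|_]; case: eqP => [->|].
rewrite mxE; case: tpermP => [->|->|/eqP/negPf -> /eqP/negPf ->//].
- by rewrite eqxx.
- by rewrite eq_sym (negPf c_neq) eqxx.
Qed.
End ExtendedFormulations.

(** * Size of the formulation of the permutahedron *)

Lemma sorting_network_ord : exists C, forall n, exists s : seq ('I_n * 'I_n),
  [/\ all (fun c => c.1 != c.2) s,
      (size s <= C * (up_log 2 n * 2 ^ up_log 2 n))%N
    & forall (R : realType) (x : 'cV[R]_n) (i j : 'I_n), (i < j)%N ->
        run_vec s x i 0 <= run_vec s x j 0].
Proof.
have [C net] := sorting_network; exists C => n.
have [s [ins size_s s_sorts]] := net n.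
have [s' sE] : exists s' : seq ('I_n * 'I_n), s = [seq (val c.1, val c.2) | c <- s'].
  elim: s ins {size_s s_sorts} => [|[i j] s IH] /=; first by exists [::].
  case/andP=> /andP[ij jn] /IH[s' ->].
  by exists ((Ordinal (ltn_trans ij jn), Ordinal jn) :: s').
have s'_neq : all (fun c => c.1 != c.2) s'.
  move: ins; rewrite sE /inside all_map; apply: sub_all => c /= /andP[lt_c _].
  by rewrite -val_eqE /= neq_ltn lt_c.
exists s'; split=> //; first by move: size_s; rewrite sE size_map.
move=> R x i j ij; pose y k := if insub k is Some k' then x k' 0 else 0.
have yx (k : 'I_n) : y k = x k 0 by rewrite /y valK.
rewrite -!(run_vecE s'_neq yx) -sE; apply: s_sorts.
by rewrite ij ltn_ord.
Qed.

(** For [k = up_log 2 n], [2 ^ k.-1 < n] gives [2 ^ k <= 2 * n] and, as [ln 2 <= ln n], also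
    [k * ln 2 <= 2 * ln n]. *)
Lemma up_log_mul_leq (R : realType) n : (2 <= n)%N ->
  (up_log 2 n * 2 ^ up_log 2 n)%:R <= 4 / ln 2 * (n%:R * ln n%:R) :> R.
Proof.
move=> n_ge2; have ln2_gt0 : 0 < ln 2 :> R by rewrite ln_gt0 // ltr1n.
have /andP[n_gt _] := @up_log_bounds 2 n isT n_ge2.
have k_gt0 : (0 < up_log 2 n)%N by rewrite up_log_gt0.
set k := up_log 2 n in n_gt k_gt0 *.
have n_gt0 : 0 < n%:R :> R by rewrite ltr0n; lia.
have pow_le : (2 ^ k)%:R <= 2 * n%:R :> R.
  by rewrite -natrM ler_nat -(prednK k_gt0) expnS leq_mul2l ltnW.
have ln_le a b : 0 < a -> a <= b -> ln a <= ln b :> R.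
  by move=> a_gt0 ab; rewrite ler_ln ?posrE //; exact: lt_le_trans ab.
have lnn_ge : ln 2 <= ln n%:R :> R by apply: ln_le => //; rewrite ler_nat.
have k1_le : (k.-1)%:R * ln 2 <= ln n%:R :> R.
  rewrite mulr_natl -lnXn // -natrX; apply: ln_le; rewrite ?ltr0n ?expn_gt0 //.
  by rewrite ler_nat ltnW.
have k_le : k%:R * ln 2 <= 2 * ln n%:R :> R.
  by rewrite -(prednK k_gt0) -natr1; lra.
have k_le' : k%:R <= 2 * ln n%:R / ln 2 :> R by rewrite ler_pdivlMr.
rewrite natrM; apply: le_trans (ler_pM _ _ k_le' pow_le) _ => //.
by rewrite le_eqVlt; apply/orP; left; apply/eqP; field; rewrite gt_eqF.
Qed.

Theorem theorem4 (R : realType) :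
  exists C : R,
    forall (n : nat) (P : set 'cV[R]_n) (n' f' : nat),
      polytope P ->
      (forall v : 'cV[R]_n, is_vertex P v -> P (sort_vec v)) ->
      has_extended_formulation P n' f' ->
      exists a b : nat,
        has_extended_formulation (permutahedron (group_A R n) P)
          (n' + a)%N (f' + b)%N /\
        ((2 <= n)%N ->
           a%:R <= C * (n%:R * ln n%:R) /\ b%:R <= C * (n%:R * ln n%:R)).
Proof.
have [C0 net] := sorting_network_ord.
exists ((2 * C0)%:R * (4 / ln 2)) => n P n' f' polyP sortP efP.
have [s [s_neq size_s s_sorts]] := net n.
(* Each comparator costs one variable and two inequalities; one constant serves for both counts. *)
exists (size s), (2 * size s)%N.
have efS := extended_formulation_unsort s_neq efP.
split; last first.
  move=> n_ge2; have bound : (2 * size s)%:R <=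
      (2 * C0)%:R * (4 / ln 2) * (n%:R * ln n%:R) :> R.
    rewrite -mulrA; apply: le_trans (ler_wpM2l _ (up_log_mul_leq R n_ge2)) => //.
    by rewrite -natrM ler_nat -mulnA leq_mul2l.
  by split=> //; apply: le_trans bound; rewrite ler_nat leq_pmull.
suff <- : unsort s P = permutahedron (group_A R n) P by [].
apply/seteqP; split; first exact: unsort_permutahedron.
have convS := extended_formulation_convex efS.
apply: conv_hull_sub => // _ [_ /group_A_permute[g ->] [x Px <-]].
(* For fixed [g] the points that [permute g] sends into [unsort s P] form a convex set, so it
   suffices to treat vertices. *)
suff sub : P `<=` [set x | unsort s P (permute g x)] by exact: sub.
apply: polytope_vertices => // [|v vP].
  apply/convex_setE => y z t t01 Sy Sz; rewrite /= permute_comb.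
  by move/convex_setE: convS; apply.
(* The output is sorted, hence equal to its own sort; being a permutation of [v], it is the sort of
   [v]. *)
apply: run_vec_unsort; rewrite -(sort_vec_sorted (s_sorts R (permute g v))).
have [h ->] := run_vec_permute s (permute g v).
by rewrite !sort_vec_permute; apply: sortP.
Qed.
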